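(* Let $\Sigma$ be an empty bunch (a bunch all of whose leaves are $\varnothing_m$ or $\varnothing_a$). If $\Sigma\vdash P::z:A$ in $\pi\mathrm{BI}$ with $A\in\{\mathbf{1}_m,\mathbf{1}_a\}$, then either (i) $P\equiv\overline{z}[\,]$, or (ii) $P\equiv\mathsf{spawn}[\emptyset].\overline{z}[\,]$, or (iii) there exists a process $S$ with $P\longrightarrow S$.
   Context: \textbf{Processes.} Fix an infinite set of names. Processes: $P,Q ::= \overline{x}[y].(P \mid Q)\mid x(y).P\mid\overline{x}[\,]\mid x().P\mid x\triangleleft\mathsf{inl}.P\mid x\triangleleft\mathsf{inr}.P\mid x\triangleright\{\mathsf{inl}:P,\mathsf{inr}:Q\}\mid[x\leftarrow y]\mid(\nu x)(P\mid Q)\mid\mathsf{spawn}[\sigma].P$. The name $y$ is bound in output and input, $x$ in $(\nu x)(P\mid Q)$. A spawn binding $\sigma$ is a finite partial function from names to finite sets of names with $\sigma(x)\cap\sigma(y)=\emptyset$ for distinct $x,y\in\mathrm{dom}\sigma$ and $\mathrm{dom}\sigma\cap\sigma(x)=\emptyset$; $\mathrm{restr}(\sigma)=\bigcup_{x}\sigma(x)$; $\emptyset$ denotes the empty spawn binding. $\mathrm{fn}(\mathsf{spawn}[\sigma].P)=(\mathrm{fn}(P)\setminus\mathrm{restr}\sigma)\cup\mathrm{dom}\sigma$. Processes are taken up to $\alpha$-conversion with the Barendregt convention. $\sigma_1,\sigma_2$ are independent if $\mathrm{dom}\sigma_1\cap\mathrm{dom}\sigma_2$, $\mathrm{dom}\sigma_1\cap\mathrm{restr}\sigma_2$,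 $\mathrm{restr}\sigma_1\cap\mathrm{restr}\sigma_2$, $\mathrm{dom}\sigma_2\cap\mathrm{restr}\sigma_1$ are empty. Merge: $(\sigma_1\odot\sigma_2)(x)=\bigcup\{\sigma_2(y)\mid y\in\sigma_1(x)\cap\mathrm{dom}\sigma_2\}\cup(\sigma_1(x)\setminus\mathrm{dom}\sigma_2)$ if $x\in\mathrm{dom}\sigma_1$; $=\sigma_2(x)$ if $x\notin\mathrm{dom}\sigma_1\cup\mathrm{restr}\sigma_1$; undefined otherwise. \textbf{Structural congruence} $\equiv$: smallest congruence with $(\nu x)(P\mid(\nu y)(Q\mid R))\equiv(\nu y)(Q\mid(\nu x)(P\mid R))$ if $x\notin\mathrm{fn}(Q),y\notin\mathrm{fn}(P)$; $(\nu x)(P\mid(\nu y)(Q\mid R))\equiv(\nu y)((\nu x)(P\mid Q)\mid R)$ if $x\notin\mathrm{fn}(R),y\notin\mathrm{fn}(P)$; $\mathsf{spawn}[\sigma_1].\mathsf{spawn}[\sigma_2].Q\equiv\mathsf{spawn}[\sigma_2].\mathsf{spawn}[\sigma_1].Q$ for independent $\sigma_1,\sigma_2$. \textbf{Reduction} $\longrightarrow$ ($P^{(i)}$: each free name $a$ of $P$ renamed to fresh $a_i$; $P\{y/x\}$: rename $x$ to $y$): $(\nu x)(x(y).Q\mid\overline{x}[y].(P_1\mid P_2))\to(\nu x)((\nu y)(P_1\mid Q)\mid P_2)$; $(\nu x)(\overline{x}[y].(P_1\mid P_2)\mid x(y).Q)\to(\nu x)(P_2\mid(\nu y)(P_1\mid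 Q))$; $(\nu x)(x().Q\mid\overline{x}[\,])\to Q$; $(\nu x)(\overline{x}[\,]\mid x().Q)\to Q$; $(\nu x)(x\triangleleft\ell.P\mid x\triangleright\{\mathsf{inl}:Q_{\mathsf{inl}},\mathsf{inr}:Q_{\mathsf{inr}}\})\to(\nu x)(P\mid Q_\ell)$; $(\nu x)(P\mid[y\leftarrow x])\to P\{y/x\}$ and $(\nu x)([x\leftarrow y]\mid P)\to P\{y/x\}$ if $x\ne y$, $y\notin\mathrm{fn}(P)$; if $\sigma(x)=\{x_1,\dots,x_n\}$ and $\sigma'=(\sigma\setminus\{x\})\cup[z\mapsto\{z_1,\dots,z_n\}\mid z\in\mathrm{fn}(P)\setminus\{x\}]$ then $(\nu x)(P\mid\mathsf{spawn}[\sigma].Q)\to\mathsf{spawn}[\sigma'].(\nu x_1)(P^{(1)}\mid\cdots(\nu x_n)(P^{(n)}\mid Q)\cdots)$; if $x\notin\mathrm{dom}\sigma$, $(\nu x)(P\mid\mathsf{spawn}[\sigma].Q)\to\mathsf{spawn}[\sigma].(\nu x)(P\mid Q)$ and $(\nu x)(\mathsf{spawn}[\sigma].P\mid Q)\to\mathsf{spawn}[\sigma].(\nu x)(P\mid Q)$; $\mathsf{spawn}[\sigma_1].\mathsf{spawn}[\sigma_2].P\to\mathsf{spawn}[\sigma_1\odot\sigma_2].P$; closure under evaluation contexts $E::=[\cdot]\mid\mathsf{spawn}[\sigma].E\mid(\nu x)(P\mid E)\mid(\nu x)(E\mid P)$ and under $\equiv$. \textbf{Typing.} Types $A::=\mathbf{1}_m\mid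 A*B\mid A\mathrel{-\!*}B\mid\mathbf{1}_a\mid A\wedge B\mid A\to B\mid A\vee B$. Bunches $\Delta::=\varnothing_m\mid\varnothing_a\mid x:A\mid(\Delta,\Delta)\mid(\Delta;\Delta)$ modulo commutative monoid laws for ',' (unit $\varnothing_m$) and ';' (unit $\varnothing_a$); $\Gamma(\cdot)$ a bunch with a hole; $\Delta^{(i)}$ renames names $a$ to fresh $a_i$. Rules: $\Delta_1\vdash P_1::y:A,\Delta_2\vdash P_2::x:B\Rightarrow\Delta_1,\Delta_2\vdash\overline{x}[y].(P_1\mid P_2)::x:A*B$; $\Gamma(x:B,y:A)\vdash P::z:C\Rightarrow\Gamma(x:A*B)\vdash x(y).P::z:C$; $\Delta,y:A\vdash P::x:B\Rightarrow\Delta\vdash x(y).P::x:A\mathrel{-\!*}B$; $\Delta\vdash P::y:A,\Gamma(x:B)\vdash Q::z:C\Rightarrow\Gamma(\Delta,x:A\mathrel{-\!*}B)\vdash\overline{x}[y].(P\mid Q)::z:C$; $\varnothing_m\vdash\overline{x}[\,]::x:\mathbf{1}_m$; $\Gamma(\varnothing_m)\vdash P::z:C\Rightarrow\Gamma(x:\mathbf{1}_m)\vdash x().P::z:C$; the analogous additive rules with ';', $\wedge$, $\to$, $\mathbf{1}_a$, $\varnothing_a$; $\Delta\vdash P::x:A\Rightarrow\Delta\vdash x\triangleleft\mathsf{inl}.P::x:A\vee B$; $\Delta\vdash P::x:B\Rightarrow\Delta\vdash x\triangleleft\mathsf{inr}.P::x:A\vee B$; $\Gamma(x:A)\vdash P::z:C,\Gamma(x:B)\vdash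 Q::z:C\Rightarrow\Gamma(x:A\vee B)\vdash x\triangleright\{\mathsf{inl}:P,\mathsf{inr}:Q\}::z:C$; $y:A\vdash[x\leftarrow y]::x:A$; $\Delta\vdash P::x:A,\Gamma(x:A)\vdash Q::z:C\Rightarrow\Gamma(\Delta)\vdash(\nu x)(P\mid Q)::z:C$; $\Delta_2\vdash P::z:C,\sigma:\Delta_1\Rightarrow\Delta_2\Rightarrow\Delta_1\vdash\mathsf{spawn}[\sigma].P::z:C$; closure under bunch equivalence. Spawn binding typing: $[x\mapsto\{x_1,\dots,x_n\}\mid x\in\Delta]:\Gamma(\Delta)\Rightarrow\Gamma(\Delta^{(1)};\dots;\Delta^{(n)})$; $[x\mapsto\emptyset\mid x\in\Delta_1]:\Gamma(\Delta_1;\Delta_2)\Rightarrow\Gamma(\Delta_2)$; $\sigma_1:\Delta_0\Rightarrow\Delta_1$, $\sigma_2:\Delta_1\Rightarrow\Delta_2$ give $\sigma_1\odot\sigma_2:\Delta_0\Rightarrow\Delta_2$. *)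

(* Defs.v *)
(* MathComp with finmap. *)
From mathcomp Require Import all_boot finmap.

Set Implicit Arguments.
Unset Strict Implicit.
Unset Printing Implicit Defensive.

Local Open Scope fmap_scope.
Local Open Scope fset_scope.

(* The type of names is a parameter throughout; its infinity is a hypothesis
   of the theorem.

   Processes are raw terms with named binders. Working up to alpha-conversion
   is rendered by closing structural congruence (hence reduction) and typing
   under [alpha]; the Barendregt convention becomes explicit side conditions
   that separate the bound names of a redex from its other names, and that can
   always be met by choosing an alpha-equivalent representative. *)

Inductive label := Inl | Inr.

Definition spawn_binding (name : choiceType) := {fmap name -> {fset name}}.

(* [Out x y P Q] is x[y].(P | Q), where y is bound in P only.
   [Fwd x y] is [x <- y]; [Nu x P Q] binds x in both P and Q. *)
Inductive proc (name : choiceType) : Type :=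
| Out of name & name & proc name & proc name
| In of name & name & proc name
| Close of name
| Wait of name & proc name
| Sel of name & label & proc name
| Case of name & proc name & proc name
| Fwd of name & name
| Nu of name & proc name & proc name
| Spawn of spawn_binding name & proc name.

Section SpawnBindings.
Variable name : choiceType.
Implicit Types (s t : spawn_binding name) (r : name -> name).

(* s(a), with the empty set as junk value outside the domain. *)
Definition sb_app s (a : name) : {fset name} := odflt fset0 s.[? a].

Definition restr s : {fset name} := \bigcup_(a <- domf s) sb_app s a.

Definition valid_sb s : Prop :=
  (forall a b, a \in domf s -> b \in domf s -> a != b ->
     [disjoint sb_app s a & sb_app s b]) /\
  (forall a, a \in domf s -> [disjoint domf s & sb_app s a]).

Definition independent s t : Prop :=
  [/\ [disjoint domf s & domf t], [disjoint domf s & restr t],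
      [disjoint restr s & restr t] & [disjoint domf t & restr s]].

Definition sb_merge s t : spawn_binding name :=
  [fmap a : domf s `|` (domf t `\` restr s) =>
     if val a \in domf s
     then (\bigcup_(b <- sb_app s (val a) `&` domf t) sb_app t b)
          `|` (sb_app s (val a) `\` domf t)
     else sb_app t (val a)].

Definition agree s t : Prop :=
  forall a, a \in domf s -> a \in domf t -> s.[? a] = t.[? a].

(* [a |-> {a_1, ..., a_n} | a in A], where a_i is [rs i a], indexed from 0. *)
Definition copies_sb (n : nat) (rs : nat -> name -> name) (A : {fset name}) :
    spawn_binding name :=
  [fmap a : A => [fset b in [seq rs i (val a) | i <- iota 0 n]]].

Definition discard_sb (A : {fset name}) : spawn_binding name :=
  [fmap a : A => fset0].

(* The names a_i (a in A, i < n) are pairwise distinct and outside X. *)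
Definition fresh_copies (n : nat) (rs : nat -> name -> name)
    (A X : {fset name}) : Prop :=
  (forall i a, i < n -> a \in A -> rs i a \notin X) /\
  (forall i j a b, i < n -> j < n -> a \in A -> b \in A ->
     rs i a = rs j b -> i = j /\ a = b).

Definition rename (a b : name) : name -> name :=
  fun c => if c == a then b else c.

Definition off (X : {fset name}) r : name -> name :=
  fun a => if a \in X then a else r a.

(* If r identifies names of the domain, their images are joined. *)
Definition ren_dom r s : spawn_binding name :=
  [fmap b : [fset r a | a in domf s] =>
     \bigcup_(a <- domf s | r a == val b) sb_app s a].

Definition ren_restr r s : spawn_binding name :=
  [fmap a : domf s => [fset r b | b in sb_app s (val a)]].

End SpawnBindings.

Section Processes.
Variable name : choiceType.
Implicit Types (x y z a b : name) (s : spawn_binding name).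
Implicit Types (P Q R : proc name).

Fixpoint wf_proc P : Prop :=
  match P with
  | Out _ _ P Q | Case _ P Q | Nu _ P Q => wf_proc P /\ wf_proc Q
  | In _ _ P | Wait _ P | Sel _ _ P => wf_proc P
  | Close _ | Fwd _ _ => True
  | Spawn s P => valid_sb s /\ wf_proc P
  end.

Fixpoint fn P : {fset name} :=
  match P with
  | Out x y P Q => x |` ((fn P `\ y) `|` fn Q)
  | In x y P => x |` (fn P `\ y)
  | Close x => [fset x]
  | Wait x P | Sel x _ P => x |` fn P
  | Case x P Q => x |` (fn P `|` fn Q)
  | Fwd x y => [fset x; y]
  | Nu x P Q => (fn P `|` fn Q) `\ x
  | Spawn s P => (fn P `\` restr s) `|` domf s
  end.

Fixpoint bn P : {fset name} :=
  match P with
  | Out _ y P Q => y |` (bn P `|` bn Q)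
  | In _ y P => y |` bn P
  | Close _ | Fwd _ _ => fset0
  | Wait _ P | Sel _ _ P => bn P
  | Case _ P Q => bn P `|` bn Q
  | Nu x P Q => x |` (bn P `|` bn Q)
  | Spawn s P => restr s `|` bn P
  end.

Definition pn P : {fset name} := fn P `|` bn P.

(* Renaming of the free occurrences. It does not avoid capture, so it is only
   used with targets outside [bn P]. *)
Fixpoint ren (r : name -> name) P : proc name :=
  match P with
  | Out x y P Q => Out (r x) y (ren (off [fset y] r) P) (ren r Q)
  | In x y P => In (r x) y (ren (off [fset y] r) P)
  | Close x => Close (r x)
  | Wait x P => Wait (r x) (ren r P)
  | Sel x l P => Sel (r x) l (ren r P)
  | Case x P Q => Case (r x) (ren r P) (ren r Q)
  | Fwd x y => Fwd (r x) (r y)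
  | Nu x P Q => Nu x (ren (off [fset x] r) P) (ren (off [fset x] r) Q)
  | Spawn s P => Spawn (ren_dom r s) (ren (off (restr s) r) P)
  end.

(* The smallest congruence containing E. *)
Inductive cong (E : proc name -> proc name -> Prop) :
    proc name -> proc name -> Prop :=
| cong_base P Q : E P Q -> cong E P Q
| cong_refl P : cong E P P
| cong_sym P Q : cong E P Q -> cong E Q P
| cong_trans P Q R : cong E P Q -> cong E Q R -> cong E P R
| cong_Out x y P P' Q Q' :
    cong E P P' -> cong E Q Q' -> cong E (Out x y P Q) (Out x y P' Q')
| cong_In x y P P' : cong E P P' -> cong E (In x y P) (In x y P')
| cong_Wait x P P' : cong E P P' -> cong E (Wait x P) (Wait x P')
| cong_Sel x l P P' : cong E P P' -> cong E (Sel x l P) (Sel x l P')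
| cong_Case x P P' Q Q' :
    cong E P P' -> cong E Q Q' -> cong E (Case x P Q) (Case x P' Q')
| cong_Nu x P P' Q Q' :
    cong E P P' -> cong E Q Q' -> cong E (Nu x P Q) (Nu x P' Q')
| cong_Spawn s P P' : cong E P P' -> cong E (Spawn s P) (Spawn s P').

Inductive alpha_axiom : proc name -> proc name -> Prop :=
| alpha_Out x y b P Q : b \notin pn P ->
    alpha_axiom (Out x y P Q) (Out x b (ren (rename y b) P) Q)
| alpha_In x y b P : b \notin pn P ->
    alpha_axiom (In x y P) (In x b (ren (rename y b) P))
| alpha_Nu x b P Q : b \notin pn P -> b \notin pn Q ->
    alpha_axiom (Nu x P Q)
      (Nu b (ren (rename x b) P) (ren (rename x b) Q))
| alpha_Spawn s a b P :
    a \in restr s -> b \notin restr s -> b \notin domf s -> b \notin pn P ->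
    alpha_axiom (Spawn s P)
      (Spawn (ren_restr (rename a b) s) (ren (rename a b) P)).

Definition alpha := cong alpha_axiom.

Inductive sc_axiom : proc name -> proc name -> Prop :=
| sc_alpha P Q : alpha_axiom P Q -> sc_axiom P Q
| sc_swap x y P Q R : x != y -> x \notin fn Q -> y \notin fn P ->
    sc_axiom (Nu x P (Nu y Q R)) (Nu y Q (Nu x P R))
| sc_assoc x y P Q R : x != y -> x \notin fn R -> y \notin fn P ->
    sc_axiom (Nu x P (Nu y Q R)) (Nu y (Nu x P Q) R)
| sc_spawn s1 s2 Q : independent s1 s2 ->
    sc_axiom (Spawn s1 (Spawn s2 Q)) (Spawn s2 (Spawn s1 Q)).

Definition sc := cong sc_axiom.

(* In [step_spawn_cut], [xs] enumerates s(x), [rs i] sends x to the i-th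
   element of [xs] and every other free name a of P to the fresh a_i, and
   [agree] says that the union of partial functions [s'] is a function. *)
Inductive step : proc name -> proc name -> Prop :=
| step_comm_l x y Q P1 P2 : x != y ->
    step (Nu x (In x y Q) (Out x y P1 P2)) (Nu x (Nu y P1 Q) P2)
| step_comm_r x y Q P1 P2 : x != y ->
    step (Nu x (Out x y P1 P2) (In x y Q)) (Nu x P2 (Nu y P1 Q))
| step_unit_l x Q : step (Nu x (Wait x Q) (Close x)) Q
| step_unit_r x Q : step (Nu x (Close x) (Wait x Q)) Q
| step_case x l P Ql Qr :
    step (Nu x (Sel x l P) (Case x Ql Qr))
         (Nu x P (match l with Inl => Ql | Inr => Qr end))
| step_fwd_r x y P : x != y -> y \notin fn P -> y \notin bn P ->
    step (Nu x P (Fwd y x)) (ren (rename x y) P)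
| step_fwd_l x y P : x != y -> y \notin fn P -> y \notin bn P ->
    step (Nu x (Fwd x y) P) (ren (rename x y) P)
| step_spawn_cut x P s Q (xs : seq name) (rs : nat -> name -> name) :
    let n := size xs in
    let s' := copies_sb n rs (fn P `\ x) in
    x \in domf s ->
    uniq xs -> xs =i sb_app s x ->
    (forall i, i < n -> rs i x = nth x xs i) ->
    fresh_copies n rs (fn P `\ x)
      (x |` (pn P `|` pn Q `|` domf s `|` restr s)) ->
    [disjoint restr s & pn P] ->
    agree s.[~ x] s' ->
    step (Nu x P (Spawn s Q))
         (Spawn (s.[~ x] + s')%fmap
            (foldr (fun i R => Nu (nth x xs i) (ren (rs i) P) R)
                   Q (iota 0 n)))
| step_spawn_r x P s Q :
    x \notin domf s -> x \notin restr s -> [disjoint restr s & fn P] ->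
    step (Nu x P (Spawn s Q)) (Spawn s (Nu x P Q))
| step_spawn_l x s P Q :
    x \notin domf s -> x \notin restr s -> [disjoint restr s & fn Q] ->
    step (Nu x (Spawn s P) Q) (Spawn s (Nu x P Q))
| step_merge s1 s2 P : [disjoint restr s2 & domf s1 `|` restr s1] ->
    step (Spawn s1 (Spawn s2 P)) (Spawn (sb_merge s1 s2) P)
| step_ctx_spawn s P P' : step P P' -> step (Spawn s P) (Spawn s P')
| step_ctx_nu_r x P Q Q' : step Q Q' -> step (Nu x P Q) (Nu x P Q')
| step_ctx_nu_l x P P' Q : step P P' -> step (Nu x P Q) (Nu x P' Q)
| step_sc P P' Q' Q : sc P P' -> step P' Q' -> sc Q' Q -> step P Q.

End Processes.

Inductive type :=
| OneM
| Star of type & type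
| Wand of type & type
| OneA
| And of type & type
| Imp of type & type
| Or of type & type.

(* [Comma] and [EmptyM] are the multiplicative bunch former and its unit;
   [Semi] and [EmptyA] are the additive ones. *)
Inductive bunch (name : choiceType) : Type :=
| EmptyM
| EmptyA
| Leaf of name & type
| Comma of bunch name & bunch name
| Semi of bunch name & bunch name.
Arguments EmptyM {name}.
Arguments EmptyA {name}.

Inductive bctx (name : choiceType) : Type :=
| Hole
| CommaL of bctx name & bunch name
| CommaR of bunch name & bctx name
| SemiL of bctx name & bunch name
| SemiR of bunch name & bctx name.

Section Typing.
Variable name : choiceType.
Implicit Types (x y z : name) (s : spawn_binding name).
Implicit Types (P Q : proc name) (A B C : type).
Implicit Types (D : bunch name) (G : bctx name).

Fixpoint fill G D : bunch name :=
  match G with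
  | Hole => D
  | CommaL G D' => Comma (fill G D) D'
  | CommaR D' G => Comma D' (fill G D)
  | SemiL G D' => Semi (fill G D) D'
  | SemiR D' G => Semi D' (fill G D)
  end.

Fixpoint bunch_names D : seq name :=
  match D with
  | EmptyM | EmptyA => [::]
  | Leaf x _ => [:: x]
  | Comma D1 D2 | Semi D1 D2 => bunch_names D1 ++ bunch_names D2
  end.

Definition bdom D : {fset name} := [fset x in bunch_names D].

Fixpoint ren_bunch (r : name -> name) D : bunch name :=
  match D with
  | EmptyM => EmptyM
  | EmptyA => EmptyA
  | Leaf x A => Leaf (r x) A
  | Comma D1 D2 => Comma (ren_bunch r D1) (ren_bunch r D2)
  | Semi D1 D2 => Semi (ren_bunch r D1) (ren_bunch r D2)
  end.

Fixpoint empty_bunch D : bool :=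
  match D with
  | EmptyM | EmptyA => true
  | Leaf _ _ => false
  | Comma D1 D2 | Semi D1 D2 => empty_bunch D1 && empty_bunch D2
  end.

Inductive bequiv : bunch name -> bunch name -> Prop :=
| beq_refl D : bequiv D D
| beq_sym D1 D2 : bequiv D1 D2 -> bequiv D2 D1
| beq_trans D1 D2 D3 : bequiv D1 D2 -> bequiv D2 D3 -> bequiv D1 D3
| beq_Comma D1 D1' D2 D2' :
    bequiv D1 D1' -> bequiv D2 D2' -> bequiv (Comma D1 D2) (Comma D1' D2')
| beq_Semi D1 D1' D2 D2' :
    bequiv D1 D1' -> bequiv D2 D2' -> bequiv (Semi D1 D2) (Semi D1' D2')
| beq_CommaC D1 D2 : bequiv (Comma D1 D2) (Comma D2 D1)
| beq_CommaA D1 D2 D3 :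
    bequiv (Comma D1 (Comma D2 D3)) (Comma (Comma D1 D2) D3)
| beq_Comma1 D : bequiv (Comma EmptyM D) D
| beq_SemiC D1 D2 : bequiv (Semi D1 D2) (Semi D2 D1)
| beq_SemiA D1 D2 D3 :
    bequiv (Semi D1 (Semi D2 D3)) (Semi (Semi D1 D2) D3)
| beq_Semi1 D : bequiv (Semi EmptyA D) D.

(* The n-ary ';' of contraction is EmptyA when n = 0, which is an instance of
   weakening up to [bequiv]. *)
Inductive sb_typed : spawn_binding name -> bunch name -> bunch name -> Prop :=
| SB_contract G D n (rs : nat -> name -> name) :
    fresh_copies n rs (bdom D) (bdom (fill G D)) ->
    sb_typed (copies_sb n rs (bdom D))
      (fill G D)
      (fill G (\big[@Semi name/EmptyA]_(i < n) ren_bunch (rs i) D))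
| SB_weaken G D1 D2 :
    sb_typed (discard_sb (bdom D1)) (fill G (Semi D1 D2)) (fill G D2)
| SB_merge s1 s2 D0 D1 D2 :
    sb_typed s1 D0 D1 -> sb_typed s2 D1 D2 -> valid_sb (sb_merge s1 s2) ->
    sb_typed (sb_merge s1 s2) D0 D2
| SB_bequiv s D1 D1' D2 D2' :
    bequiv D1 D1' -> bequiv D2 D2' -> sb_typed s D1 D2 -> sb_typed s D1' D2'.

(* The names declared by a judgment D |- P :: z : C are distinct. *)
Definition distinct D z : bool := uniq (z :: bunch_names D).

Inductive typed : bunch name -> proc name -> name -> type -> Prop :=
| T_StarR D1 D2 P1 P2 x y A B : distinct (Comma D1 D2) x ->
    typed D1 P1 y A -> typed D2 P2 x B ->
    typed (Comma D1 D2) (Out x y P1 P2) x (Star A B)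
| T_StarL G P x y z A B C : distinct (fill G (Leaf x (Star A B))) z ->
    typed (fill G (Comma (Leaf x B) (Leaf y A))) P z C ->
    typed (fill G (Leaf x (Star A B))) (In x y P) z C
| T_WandR D P x y A B : distinct D x ->
    typed (Comma D (Leaf y A)) P x B ->
    typed D (In x y P) x (Wand A B)
| T_WandL G D P Q x y z A B C :
    distinct (fill G (Comma D (Leaf x (Wand A B)))) z ->
    typed D P y A -> typed (fill G (Leaf x B)) Q z C ->
    typed (fill G (Comma D (Leaf x (Wand A B)))) (Out x y P Q) z C
| T_OneMR x : typed EmptyM (Close x) x OneM
| T_OneML G P x z C : distinct (fill G (Leaf x OneM)) z ->
    typed (fill G EmptyM) P z C ->
    typed (fill G (Leaf x OneM)) (Wait x P) z C
| T_AndR D1 D2 P1 P2 x y A B : distinct (Semi D1 D2) x ->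
    typed D1 P1 y A -> typed D2 P2 x B ->
    typed (Semi D1 D2) (Out x y P1 P2) x (And A B)
| T_AndL G P x y z A B C : distinct (fill G (Leaf x (And A B))) z ->
    typed (fill G (Semi (Leaf x B) (Leaf y A))) P z C ->
    typed (fill G (Leaf x (And A B))) (In x y P) z C
| T_ImpR D P x y A B : distinct D x ->
    typed (Semi D (Leaf y A)) P x B ->
    typed D (In x y P) x (Imp A B)
| T_ImpL G D P Q x y z A B C :
    distinct (fill G (Semi D (Leaf x (Imp A B)))) z ->
    typed D P y A -> typed (fill G (Leaf x B)) Q z C ->
    typed (fill G (Semi D (Leaf x (Imp A B)))) (Out x y P Q) z C
| T_OneAR x : typed EmptyA (Close x) x OneA
| T_OneAL G P x z C : distinct (fill G (Leaf x OneA)) z ->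
    typed (fill G EmptyA) P z C ->
    typed (fill G (Leaf x OneA)) (Wait x P) z C
| T_OrR1 D P x A B : distinct D x ->
    typed D P x A -> typed D (Sel x Inl P) x (Or A B)
| T_OrR2 D P x A B : distinct D x ->
    typed D P x B -> typed D (Sel x Inr P) x (Or A B)
| T_OrL G P Q x z A B C : distinct (fill G (Leaf x (Or A B))) z ->
    typed (fill G (Leaf x A)) P z C -> typed (fill G (Leaf x B)) Q z C ->
    typed (fill G (Leaf x (Or A B))) (Case x P Q) z C
| T_Fwd x y A : distinct (Leaf y A) x ->
    typed (Leaf y A) (Fwd x y) x A
| T_Cut G D P Q x z A C : distinct (fill G D) z ->
    typed D P x A -> typed (fill G (Leaf x A)) Q z C ->
    typed (fill G D) (Nu x P Q) z C
| T_Spawn s D1 D2 P z C : distinct D1 z ->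
    typed D2 P z C -> sb_typed s D1 D2 ->
    typed D1 (Spawn s P) z C
| T_bequiv D D' P z C : bequiv D D' -> typed D P z C -> typed D' P z C
| T_alpha D P P' z C : alpha P P' -> typed D P z C -> typed D P' z C.

End Typing.

(* Main.v *)
Require Import Defs.
From mathcomp Require Import all_boot finmap.

(* Every typed process is alpha-equivalent to one that either reduces, or is a
   spawn prefix over a process without one, or has an unguarded action on its
   own channel or on a channel of its context. At a cut on x the two sides are
   tried in turn: a spawn prefix on either side always moves out; if the client
   waits on x, then the provider either acts on x too, and structural
   congruence brings the two dual actions together (cut names being used
   linearly), or it waits on a channel of its own context; otherwise the cut
   inherits the action of the client. With an empty context and a unit type,
   only a close on z can be left.

   Reducing a cut requires the bound names of either side to avoid the names of
   the other, so all binders are first renamed to fresh names. *)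

Set Implicit Arguments.
Unset Strict Implicit.
Unset Printing Implicit Defensive.

Local Open Scope fmap_scope.
Local Open Scope fset_scope.

(** Of the type of a channel only the action of its provider is kept ([action_of]): this is all that
    two dual prefixes must agree on, so the cut argument works with free names, well-formedness and
    readiness, and never types a renamed or rearranged process. Two obstacles shape the rest. First,
    [step] does not check the spawn bindings that it builds, whereas the reduct must be well formed;
    validity is therefore followed through merging and through the copying of a provider. Second,
    typing is closed under alpha-equivalence, so a derivation does not fix the shape of its subject;
    the induction speaks of one chosen representative, and readiness is only shown to survive the
    renamings actually performed. *)

Definition in_setopsE := (in_fsetU, in_fsetD, in_fsetI, in_fset1, in_fset0).

(** Proves set identities pointwise: every atom [a \in A] or [a == b] is split, and hypotheses left
    in the goal as implications are used once their premise has become true. *)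
Ltac membership_cases :=
  rewrite ?in_setopsE; repeat match goal with
  | |- context [?x \in ?A] => case: (x \in A)
  | |- context [?x == ?y] => case: (x == y)
  end; do ?[by []|move/(_ isT)|move=> _].

Ltac subset_cases := apply/fsubsetP => ?; membership_cases.

(** * Spawn bindings: renaming, copying, merging, validity *)

Section SpawnBindingTheory.
Variable name : choiceType.
Implicit Types (s t : spawn_binding name) (r : name -> name).
Implicit Types (a b c : name) (A B X : {fset name}).

Lemma sb_app_fmap A (f : name -> {fset name}) a :
  sb_app [fmap b : A => f (val b)] a = if a \in A then f a else fset0.
Proof.
by rewrite /sb_app; case: fndP => // aA; rewrite ffunE.
Qed.

Lemma sb_app_out s a : a \notin domf s -> sb_app s a = fset0.
Proof. by move=> aNs; rewrite /sb_app not_fnd. Qed.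

Lemma sb_app_dom s a b : b \in sb_app s a -> a \in domf s.
Proof. by case: (boolP (a \in domf s)) => // /sb_app_out ->. Qed.

Lemma restrP s b : reflect (exists a, b \in sb_app s a) (b \in restr s).
Proof.
apply: (iffP (bigfcupP _ _ _ _)) => [[a _ ba]|[a ba]]; first by exists a.
by exists a => //; rewrite (sb_app_dom ba).
Qed.

Lemma sb_app_restr s a b : b \in sb_app s a -> b \in restr s.
Proof. by move=> ba; apply/restrP; exists a. Qed.

(** Since [sb_app] is empty outside the domain, disjointness of the images becomes uniqueness of the
    source of a restricted name, with no side condition on domains. *)
Lemma valid_sbP s :
  valid_sb s <->
  (forall a b c, c \in sb_app s a -> c \in sb_app s b -> a = b) /\
  [disjoint domf s & restr s].
Proof.
split=> [[inj dis]|[inj /fdisjointP dis]]; split.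
- move=> a b c ca cb; apply/eqP/negPn/negP => ab.
  have /fdisjointP /(_ c ca) := inj _ _ (sb_app_dom ca) (sb_app_dom cb) ab.
  by rewrite cb.
- apply/fdisjointP => a aD; apply/restrP => -[b ab].
  by have /fdisjointP /(_ a aD) := dis b (sb_app_dom ab); rewrite ab.
- move=> a b _ _ ab; apply/fdisjointP => c ca; apply: contra ab => cb.
  by rewrite (inj _ _ _ ca cb).
- move=> a _; apply/fdisjointP => c /dis; apply: contra; exact: sb_app_restr.
Qed.

Lemma sb_app_ren_domE r s b :
  sb_app (ren_dom r s) b =
  if b \in r @` domf s then \bigcup_(a <- domf s | r a == b) sb_app s a
  else fset0.
Proof.
exact: (sb_app_fmap _ (fun b => \bigcup_(a <- domf s | r a == b) sb_app s a)).
Qed.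

Lemma sb_app_ren_restr r s a : sb_app (ren_restr r s) a = r @` sb_app s a.
Proof.
have -> : sb_app (ren_restr r s) a
    = if a \in domf s then r @` sb_app s a else fset0.
  exact: (sb_app_fmap _ (fun a => r @` sb_app s a)).
by case: ifP => // /negbT aNs; rewrite sb_app_out ?imfset0.
Qed.

Lemma restr_ren_dom r s : restr (ren_dom r s) = restr s.
Proof.
apply/fsetP => c; apply/restrP/restrP => -[a].
  rewrite sb_app_ren_domE; case: ifP => // _ /bigfcupP [b _ cb]; by exists b.
move=> ca; exists (r a); rewrite sb_app_ren_domE in_imfset ?(sb_app_dom ca) //.
by apply/bigfcupP; exists a => //; rewrite (sb_app_dom ca) eqxx.
Qed.

Lemma sb_app_ren_dom r s a c :
  c \in sb_app (ren_dom r s) a -> exists2 b, c \in sb_app s b & a = r b.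
Proof.
rewrite sb_app_ren_domE; case: ifP => // _ /bigfcupP [b /andP [_ /eqP <-] cb].
by exists b.
Qed.

Lemma restr_ren_restr r s : restr (ren_restr r s) = r @` restr s.
Proof.
apply/fsetP => c; apply/restrP/imfsetP => /= [[a]|[b /restrP [a ba] ->]].
  rewrite sb_app_ren_restr => /imfsetP [b /= ba ->].
  by exists b => //; apply: sb_app_restr ba.
by exists a; rewrite sb_app_ren_restr in_imfset.
Qed.

Lemma valid_ren_restr r s :
  {in restr s &, injective r} -> [disjoint domf s & r @` restr s] ->
  valid_sb s -> valid_sb (ren_restr r s).
Proof.
move=> inj dis /valid_sbP [injs _]; apply/valid_sbP; split; last first.
  by rewrite restr_ren_restr.
move=> a b c; rewrite !sb_app_ren_restr.
move=> /imfsetP [d /= da ->] /imfsetP [e /= eb].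
move=> /(inj _ _ (sb_app_restr da) (sb_app_restr eb)) de.
by apply: injs da _; rewrite de.
Qed.

Lemma restr_discard A : restr (discard_sb A) = fset0.
Proof.
apply/eqP/fset0Pn => -[b /restrP [a]].
by rewrite (sb_app_fmap A (fun=> fset0)); case: ifP.
Qed.

Lemma valid_discard A : valid_sb (discard_sb A).
Proof.
apply/valid_sbP; rewrite restr_discard fdisjointX0; split=> // a b c.
by move/sb_app_restr; rewrite restr_discard.
Qed.

Lemma sb_app_copies n (rs : nat -> name -> name) A a c :
  reflect (exists2 i, i < n & a \in A /\ c = rs i a)
          (c \in sb_app (copies_sb n rs A) a).
Proof.
rewrite (sb_app_fmap A (fun a => [fset b in [seq rs i a | i <- iota 0 n]])).
case: ifP => aA; last by constructor=> -[i _ []].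
rewrite in_fset /=; apply: (iffP mapP) => -[i].
  by rewrite mem_iota => /andP [_ iP] ->; exists i.
by move=> iP [_ ->]; exists i; rewrite ?mem_iota.
Qed.

Lemma restr_copies n (rs : nat -> name -> name) A c :
  reflect (exists i a, [/\ i < n, a \in A & c = rs i a])
          (c \in restr (copies_sb n rs A)).
Proof.
apply: (iffP (restrP _ _)).
  by move=> [a /sb_app_copies [i iP [aA ->]]]; exists i, a.
by move=> [i [a [iP aA ->]]]; exists a; apply/sb_app_copies; exists i.
Qed.

Lemma copies_inj n (rs : nat -> name -> name) A X a b c :
  fresh_copies n rs A X ->
  c \in sb_app (copies_sb n rs A) a -> c \in sb_app (copies_sb n rs A) b ->
  a = b.
Proof.
move=> [_ inj] /sb_app_copies [i iP [aA ->]] /sb_app_copies [j jP [bA]].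
by case/inj.
Qed.

Lemma restr_copies_fresh n (rs : nat -> name -> name) A X :
  fresh_copies n rs A X -> [disjoint restr (copies_sb n rs A) & X].
Proof.
by move=> [out _]; apply/fdisjointP => c /restr_copies [i [a [iP aA ->]]];
   apply: out.
Qed.

Lemma valid_copies n (rs : nat -> name -> name) A X :
  A `<=` X -> fresh_copies n rs A X -> valid_sb (copies_sb n rs A).
Proof.
move=> /fsubsetP AX fr; apply/valid_sbP; split.
  by move=> a b c; apply: copies_inj fr.
by rewrite fdisjoint_sym; apply: fdisjointWr (restr_copies_fresh fr); apply/fsubsetP.
Qed.

Lemma sb_app_mergeE s t a :
  sb_app (sb_merge s t) a =
  if a \in domf s `|` (domf t `\` restr s) then
    if a \in domf s
    then (\bigcup_(b <- sb_app s a `&` domf t) sb_app t b)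
         `|` (sb_app s a `\` domf t)
    else sb_app t a
  else fset0.
Proof.
exact: (sb_app_fmap _ (fun a => if a \in domf s
  then (\bigcup_(b <- sb_app s a `&` domf t) sb_app t b)
       `|` (sb_app s a `\` domf t)
  else sb_app t a)).
Qed.

Lemma sb_app_merge s t a c :
  c \in sb_app (sb_merge s t) a ->
  [\/ exists2 b, b \in sb_app s a & c \in sb_app t b,
      c \in sb_app s a /\ c \notin domf t |
      [/\ a \notin domf s, a \notin restr s & c \in sb_app t a]].
Proof.
rewrite sb_app_mergeE; case: ifP => //; case: ifP => [as_ _|as_].
  rewrite in_fsetU in_fsetD => /orP [/bigfcupP [b]|/andP [? ?]].
    by rewrite inE andbT => /andP [ba _] cb; apply: Or31; exists b.
  by apply: Or32.
by rewrite !inE as_ /= => /andP [? _] ?; apply: Or33.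
Qed.

(** A name in both domains keeps only its image under [s] in the merge; its image under [t] survives
    because [s] restricts that name, hence composes some image with [t]. *)
Lemma restr_merge s t : domf s `&` domf t `<=` restr s ->
  restr (sb_merge s t) = restr t `|` (restr s `\` domf t).
Proof.
move=> /fsubsetP st; apply/fsetP => c; rewrite !inE.
apply/restrP/idP => [[a /sb_app_merge [[b _ /sb_app_restr -> //]|[]|[]]]|].
- by move=> /sb_app_restr -> ->; rewrite orbT.
- by move=> _ _ /sb_app_restr ->.
case/orP => [/restrP [b cb]|/andP [ct /restrP [a ca]]].
  have bt := sb_app_dom cb; have [bs|bs] := boolP (b \in restr s).
    have [a ba] := restrP _ _ bs; exists a.
    rewrite sb_app_mergeE !inE (sb_app_dom ba) /= inE; apply/orP; left.
    by apply/bigfcupP; exists b => //; rewrite inE ba bt.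
  have bNs : b \notin domf s.
    by apply: contra bs => bs; apply: st; rewrite inE bs bt.
  by exists b; rewrite sb_app_mergeE !inE (negPf bNs) bt bs.
by exists a; rewrite sb_app_mergeE !inE (sb_app_dom ca) /= !inE ct ca orbT.
Qed.

(** A name in an image of the merge comes through both bindings, from [s] alone or from [t] alone.
    Names restricted by [t] being fresh for [s], two different origins cannot meet, and equal
    origins have the same source. *)
Lemma valid_merge s t : valid_sb s -> valid_sb t ->
  [disjoint restr t & domf s `|` restr s] -> valid_sb (sb_merge s t).
Proof.
move=> /valid_sbP [injs /fdisjointP dis] /valid_sbP [injt /fdisjointP dit].
move=> /fdisjointP dst; apply/valid_sbP; split.
  have tNs a c : c \in sb_app t a -> c \notin restr s.
    by move=> /sb_app_restr /dst; rewrite !inE negb_or => /andP [].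
  have abs a c : c \in restr s -> c \in sb_app t a -> False.
    by move=> cs /tNs; rewrite cs.
  move=> a b c /sb_app_merge [[d da cd]|[ca _]|[_ as_ ca]]
               /sb_app_merge [[e eb ce]|[cb _]|[_ bs cb]].
  - by apply: injs da _; rewrite (injt _ _ _ cd ce).
  - by case: (abs _ _ (sb_app_restr cb) cd).
  - by move: bs; rewrite -(injt _ _ _ cd cb) (sb_app_restr da).
  - by case: (abs _ _ (sb_app_restr ca) ce).
  - exact: injs ca cb.
  - by case: (abs _ _ (sb_app_restr ca) cb).
  - by move: as_; rewrite (injt _ _ _ ca ce) (sb_app_restr eb).
  - by case: (abs _ _ (sb_app_restr cb) ca).
  - exact: injt ca cb.
apply/fdisjointP => a adom; apply/restrP => -[b].
have adom' : a \in domf s \/ a \in domf t /\ a \notin restr s.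
  move: adom; rewrite /= !inE => /orP [->|/andP [-> ->]]; by [left|right].
case/sb_app_merge => [[c _ /sb_app_restr ac]|[/sb_app_restr ac _]|[_ _ /sb_app_restr ac]].
- have := dst _ ac; rewrite !inE negb_or => /andP [/negPf e1 e2].
  by case: adom'; rewrite ?e1 // => -[/dit]; rewrite ac.
- by case: adom' => [/dis|[]]; rewrite ac.
- have := dst _ ac; rewrite !inE negb_or => /andP [/negPf e1 e2].
  by case: adom'; rewrite ?e1 // => -[/dit]; rewrite ac.
Qed.

End SpawnBindingTheory.

(** * Renaming without capture *)

Section Renaming.
Variable name : choiceType.
Implicit Types (s : spawn_binding name) (r : name -> name).
Implicit Types (a b x y z : name) (A B F X : {fset name}) (P Q : proc name).

(* A free name that is also bound is allowed if [r] fixes it: raw terms need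
   not satisfy the Barendregt convention. *)
Definition capture_free r F B :=
  {in F &, injective r} /\ (forall a, a \in F -> r a = a \/ r a \notin B).

Lemma capture_freeS r F B F1 B1 :
  capture_free r F B -> F1 `<=` F -> B1 `<=` B -> capture_free r F1 B1.
Proof.
move=> [inj cf] /fsubsetP FF /fsubsetP BB; split.
  by move=> a b /FF aF /FF bF; apply: inj.
by move=> a /FF /cf [|/negP rB]; [left|right; apply/negP => /BB].
Qed.

Lemma capture_free_notin r F B X a : capture_free r F B -> X `<=` B ->
  a \in F -> a \notin X -> r a \notin X.
Proof.
move=> [_ cf] /fsubsetP XB /cf [-> //|raB] _.
by apply: contra raB => /XB.
Qed.

(** This is the passage under a binder: no free name outside [X] is sent into [X], so fixing [X]
    does not break injectivity. *)
Lemma capture_free_off r F B F1 B1 X :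
  capture_free r F B -> F1 `\` X `<=` F -> X `|` B1 `<=` B ->
  capture_free (off X r) F1 B1.
Proof.
move=> cf /fsubsetP FF; rewrite fsubUset => /andP [XB /fsubsetP BB].
have inF a : a \in F1 -> a \notin X -> a \in F.
  by move=> aF aX; apply: FF; rewrite inE aX.
split=> [a b aF bF|a aF]; rewrite /off.
  case: ifP => [aX|/negbT aX]; case: ifP => [bX|/negbT bX] //.
  - by move=> ab; have := capture_free_notin cf XB (inF _ bF bX) bX; rewrite -ab aX.
  - by move=> ab; have := capture_free_notin cf XB (inF _ aF aX) aX; rewrite ab bX.
  - by apply: cf.1; apply: inF.
case: ifP => [|/negbT aX]; first by left.
case: (cf.2 _ (inF _ aF aX)); first by left.
by move=> /negP rB; right; apply/negP => /BB.
Qed.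

Lemma imfset_off r F B F1 X :
  capture_free r F B -> F1 `\` X `<=` F -> X `<=` B ->
  (off X r @` F1) `\` X = r @` (F1 `\` X).
Proof.
move=> cf /fsubsetP FF XB; apply/fsetP => c; rewrite inE.
apply/andP/imfsetP => /= [[cX /imfsetP [a /= aF cE]]|[a aFX ->]].
  move: cE cX; rewrite /off; case: ifP => [aX -> /negP //|aX cE _].
  by exists a => //; rewrite inE aX.
rewrite (capture_free_notin cf XB) ?FF //; last by move: aFX; rewrite inE => /andP [].
split=> //; apply/imfsetP; exists a; first by move: aFX; rewrite inE => /andP [].
by move: aFX; rewrite /off inE => /andP [/negPf ->].
Qed.

Lemma capture_free_rename a b F B :
  b \notin F `|` B -> capture_free (rename a b) F B.
Proof.
rewrite inE negb_or => /andP [bF bB]; split=> [c d cF dF|c cF]; rewrite /rename.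
  case: eqP => [->|_]; case: eqP => [->|_] // E.
    by move: bF; rewrite E dF.
  by move: bF; rewrite -E cF.
by case: eqP; [right|left].
Qed.

Lemma imfset_rename a b F : a \in F -> rename a b @` F = b |` (F `\ a).
Proof.
move=> aF; apply/fsetP => c; rewrite !inE; apply/imfsetP/orP => /=.
  move=> [d dF ->]; rewrite /rename; case: (eqVneq d a) => [_|da].
    by rewrite eqxx; left.
  by right; rewrite da dF.
case=> [/eqP ->|/andP [/negPf ca cF]].
  by exists a; rewrite // /rename eqxx.
by exists c; rewrite // /rename ca.
Qed.

Lemma imfset_rename_out a b F : a \notin F -> rename a b @` F = F.
Proof.
move=> aF; apply/fsetP => c; apply/imfsetP/idP => /= [[d dF ->]|cF].
  by rewrite /rename; case: eqP dF aF => // -> ->.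
by exists c; rewrite // /rename; case: eqP cF aF => // -> ->.
Qed.

(** This is why changing a binder from [a] to a fresh [b] preserves the free names of the whole
    term. *)
Lemma imfset_renameD a b F : b \notin F -> (rename a b @` F) `\ b = F `\ a.
Proof.
move=> bF; have [aF|aF] := boolP (a \in F).
  rewrite imfset_rename //; apply/fsetP => c; rewrite !inE.
  by case: (eqVneq c b) => [->|] //=; rewrite (negPf bF) andbF.
by rewrite imfset_rename_out // !mem_fsetD1.
Qed.

Lemma bn_ren r P : bn (ren r P) = bn P.
Proof.
elim: P r => [x y P IHP Q IHQ|x y P IH|x|x P IH|x l P IH|x P IHP Q IHQ|x y|
  x P IHP Q IHQ|s P IH] r //=; rewrite ?IH ?IHP ?IHQ ?restr_ren_dom //.
Qed.

Lemma fn_ren r P : capture_free r (fn P) (bn P) -> fn (ren r P) = r @` fn P.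
Proof.
elim: P r => [x y P IHP Q IHQ|x y P IH|x|x P IH|x l P IH|x P IHP Q IHQ|x y|
  x P IHP Q IHQ|s P IH] r /= cf.
- rewrite IHP ?IHQ; [|by apply: capture_freeS cf _ _; subset_cases|
    by apply: capture_free_off cf _ _; subset_cases].
  by rewrite (imfset_off cf) ?imfsetU1 ?imfsetU //; subset_cases.
- rewrite IH; last by apply: capture_free_off cf _ _; subset_cases.
  by rewrite (imfset_off cf) ?imfsetU1 //; subset_cases.
- by rewrite imfset_fset1.
- by rewrite IH ?imfsetU1 //; apply: capture_freeS cf _ _; subset_cases.
- by rewrite IH ?imfsetU1 //; apply: capture_freeS cf _ _; subset_cases.
- rewrite IHP ?IHQ ?imfsetU1 ?imfsetU //; apply: capture_freeS cf _ _;
    subset_cases.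
- by rewrite imfset_fset2.
- rewrite IHP ?IHQ; try by apply: capture_free_off cf _ _; subset_cases.
  by rewrite -imfsetU (imfset_off cf) //; subset_cases.
- rewrite IH; last by apply: capture_free_off cf _ _; subset_cases.
  by rewrite restr_ren_dom (imfset_off cf) ?imfsetU //; subset_cases.
Qed.

(** In a spawn prefix only the domain is renamed, possibly with names joined; being free, it cannot
    be sent onto the restricted names, which are bound. *)
Lemma wf_ren r P : capture_free r (fn P) (bn P) -> wf_proc P ->
  wf_proc (ren r P).
Proof.
elim: P r => [x y P IHP Q IHQ|x y P IH|x|x P IH|x l P IH|x P IHP Q IHQ|x y|
  x P IHP Q IHQ|s P IH] r //= cf.
- case=> wP wQ; split; [apply: IHP|apply: IHQ] => //.
    by apply: capture_free_off cf _ _; subset_cases.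
  by apply: capture_freeS cf _ _; subset_cases.
- by apply: IH; apply: capture_free_off cf _ _; subset_cases.
- by apply: IH; apply: capture_freeS cf _ _; subset_cases.
- by apply: IH; apply: capture_freeS cf _ _; subset_cases.
- case=> wP wQ; split; [apply: IHP|apply: IHQ] => //;
  by apply: capture_freeS cf _ _; subset_cases.
- case=> wP wQ; split; [apply: IHP|apply: IHQ] => //;
  by apply: capture_free_off cf _ _; subset_cases.
- case=> /valid_sbP [inj /fdisjointP dis] wP; split; last first.
    by apply: IH => //; apply: capture_free_off cf _ _; subset_cases.
  apply/valid_sbP; rewrite restr_ren_dom; split.
    move=> a b c /sb_app_ren_dom [d cd ->] /sb_app_ren_dom [e ce ->].
    by rewrite (inj _ _ _ cd ce).
  apply/fdisjointP => _ /imfsetP [a /= aD ->].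
  apply: (capture_free_notin cf) (dis _ aD); first by subset_cases.
  by rewrite inE aD orbT.
Qed.

End Renaming.

(* The four ways in which the two sides of a cut can interact, seen from the
   provider: it sends, receives, terminates or selects. *)
Inductive action := Send | Receive | Terminate | Select.

(** * Unguarded actions, and the refreshing of binders *)

Section Readiness.
Variable name : choiceType.
Implicit Types (s : spawn_binding name) (r : name -> name) (k : action).
Implicit Types (a b x y z u : name) (A B F X : {fset name}) (P Q : proc name).

(* The side conditions in the cut cases hold by linearity of cut names; they
   are what the structural congruences that bring redexes together need. *)
Inductive provides : action -> name -> proc name -> Prop :=
| provides_Out x y P Q : provides Send x (Out x y P Q)
| provides_In x y P : provides Receive x (In x y P)
| provides_Close x : provides Terminate x (Close x)
| provides_Sel x l P : provides Select x (Sel x l P)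
| provides_Nu k x z P Q : z != x -> z \notin fn P -> x \in fn Q ->
    provides k z Q -> provides k z (Nu x P Q).

(** A forwarder is ready for whatever the provider of its source does, so it demands every action
    there; it counts as waiting on its context. A demand may come from either side of a cut, whereas
    the provided channel of a cut is that of its right side. *)
Inductive demands : action -> name -> proc name -> Prop :=
| demands_In x y P : demands Send x (In x y P)
| demands_Out x y P Q : demands Receive x (Out x y P Q)
| demands_Wait x P : demands Terminate x (Wait x P)
| demands_Case x P Q : demands Select x (Case x P Q)
| demands_Fwd k x y : x != y -> demands k y (Fwd x y)
| demands_Nu_l k x u P Q : u != x -> u \notin fn Q ->
    demands k u P -> demands k u (Nu x P Q)
| demands_Nu_r k x u P Q : u != x -> u \notin fn P ->
    demands k u Q -> demands k u (Nu x P Q).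

(** The presence of a prefix and its domain are what survives a renaming of the restricted names. *)
Definition spawn_dom P : option {fset name} :=
  if P is Spawn s _ then Some (domf s) else None.

Lemma provides_fn k z P : provides k z P -> z \in fn P.
Proof.
elim=> *; rewrite /= ?inE ?eqxx //.
by apply/andP; split=> //; apply/orP; right.
Qed.

Lemma demands_fn k u P : demands k u P -> u \in fn P.
Proof.
elim=> * /=; rewrite ?inE ?eqxx ?orbT //.
  by apply/andP; split=> //; apply/orP; left.
by apply/andP; split=> //; apply/orP; right.
Qed.

(** Below a cut on [x] the right side would be [Close z], in which the cut name [x] is not free. *)
Lemma provides_Terminate z P : provides Terminate z P -> P = Close z.
Proof.
move: {1 3}Terminate (erefl Terminate) => k E H.
elim: H E => // {}k x {}z {}P Q zx _ xQ _ IH /IH QE.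
by move: xQ zx; rewrite QE inE => /eqP ->; rewrite eqxx.
Qed.

Section RenNu.
Variables (r : name -> name) (x : name) (P Q : proc name).
Hypothesis cf : capture_free r (fn (Nu x P Q)) (bn (Nu x P Q)).

Lemma capture_free_Nu_l : capture_free (off [fset x] r) (fn P) (bn P).
Proof. by apply: capture_free_off cf _ _ => /=; subset_cases. Qed.

Lemma capture_free_Nu_r : capture_free (off [fset x] r) (fn Q) (bn Q).
Proof. by apply: capture_free_off cf _ _ => /=; subset_cases. Qed.

Lemma ren_Nu_neq z : z \in fn (Nu x P Q) -> r z != x.
Proof.
move=> zF; rewrite -in_fset1; apply: (capture_free_notin cf) (zF) _.
  by rewrite /=; subset_cases.
by move: zF; rewrite /= !inE => /andP [].
Qed.

Lemma ren_Nu_off z : z != x -> off [fset x] r z = r z.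
Proof. by rewrite /off inE => /negPf ->. Qed.

Lemma ren_Nu_bound : off [fset x] r x = x.
Proof. by rewrite /off inE eqxx. Qed.

(** By injectivity of [r] a clash with a renamed free name of [R] is a clash before renaming; the
    binder [x] is treated apart, since it stays fixed. *)
Lemma ren_Nu_notin z R : z \in fn (Nu x P Q) ->
  fn R `\ x `<=` fn (Nu x P Q) -> capture_free (off [fset x] r) (fn R) (bn R) ->
  z \notin fn R -> r z \notin fn (ren (off [fset x] r) R).
Proof.
move=> zF /fsubsetP sub cfR zR; rewrite fn_ren //.
apply/imfsetP => -[a /= aR]; have [->|ax] := eqVneq a x.
  by rewrite ren_Nu_bound => /eqP; rewrite (negPf (ren_Nu_neq zF)).
rewrite ren_Nu_off // => /(cf.1) E; move: zR; rewrite E ?aR //.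
by apply: sub; rewrite !inE ax.
Qed.
End RenNu.

Lemma provides_ren r k z P : capture_free r (fn P) (bn P) ->
  provides k z P -> provides k (r z) (ren r P).
Proof.
move=> cf H; elim: H r cf => [x y {}P Q|x y {}P|x|x l {}P|
  {}k x {}z {}P Q zx zP xQ pz IH] r cf; rewrite [ren _ _]/=; try by constructor.
have zF : z \in fn (Nu x P Q) by rewrite /= !inE zx (provides_fn pz) orbT.
have cfQ := capture_free_Nu_r cf; constructor.
- exact (ren_Nu_neq cf zF).
- apply: (ren_Nu_notin cf zF _ (capture_free_Nu_l cf) zP).
  by rewrite /=; subset_cases.
- by rewrite fn_ren //; apply/imfsetP; exists x; rewrite ?ren_Nu_bound.
- by rewrite -(ren_Nu_off r zx); apply: IH.
Qed.

Lemma demands_ren r k u P : capture_free r (fn P) (bn P) ->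
  demands k u P -> demands k (r u) (ren r P).
Proof.
move=> cf H; elim: H r cf => [x y {}P|x y {}P Q|x {}P|x {}P Q|
  {}k x y xy|{}k x {}u {}P Q ux uQ du IH|{}k x {}u {}P Q ux uP du IH] r cf; rewrite [ren _ _]/=;
  try by constructor.
- constructor; apply: contra xy => /eqP /(cf.1) ->; rewrite // !inE eqxx //.
  by rewrite orbT.
- have uF : u \in fn (Nu x P Q) by rewrite /= !inE ux (demands_fn du).
  apply: demands_Nu_l.
  + exact (ren_Nu_neq cf uF).
  + apply: (ren_Nu_notin cf uF _ (capture_free_Nu_r cf) uQ).
    by rewrite /=; subset_cases.
  + by rewrite -(ren_Nu_off r ux); apply: IH; apply: capture_free_Nu_l cf.
- have uF : u \in fn (Nu x P Q) by rewrite /= !inE ux (demands_fn du) orbT.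
  apply: demands_Nu_r.
  + exact (ren_Nu_neq cf uF).
  + apply: (ren_Nu_notin cf uF _ (capture_free_Nu_l cf) uP).
    by rewrite /=; subset_cases.
  + by rewrite -(ren_Nu_off r ux); apply: IH; apply: capture_free_Nu_r cf.
Qed.

(** The second group goes beyond alpha-equivalence: what has been established about the readiness of
    [P] must hold of the refreshed copy too. *)
Definition refreshes X P P' :=
  [/\ alpha P P', wf_proc P', fn P' = fn P & [disjoint bn P' & X]] /\
  [/\ forall k z, provides k z P -> provides k z P',
      forall k u, demands k u P -> demands k u P' &
      spawn_dom P' = spawn_dom P].

Hypothesis name_infinite : forall X, exists a : name, a \notin X.

Lemma pn_fresh b P : b \notin fn P -> b \notin bn P -> b \notin pn P.
Proof. by move=> bF bB; rewrite inE negb_or bF. Qed.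

(** The alpha axiom renames one restricted name at a time; [n] bounds how many of them still lie in
    [X], and each replacement is chosen outside [X]. *)
Lemma refresh_spawn n s P X :
  valid_sb s -> wf_proc P -> [disjoint bn P & X] ->
  #|` restr s `&` X | <= n ->
  exists s' P', [/\ alpha (Spawn s P) (Spawn s' P'), valid_sb s', wf_proc P',
                  domf s' = domf s & fn (Spawn s' P') = fn (Spawn s P)] /\
                [disjoint bn (Spawn s' P') & X].
Proof.
elim: n s P => [|n IH] s P vs wP dP card.
  exists s, P; split; first by split=> //; apply: cong_refl.
  by rewrite fdisjointUX dP andbT -fsetI_eq0 -cardfs_eq0 -leqn0.
have [E|[a]] := fset_0Vmem (restr s `&` X).
  by apply: IH => //; rewrite E cardfs0.
rewrite inE => /andP [as_ aX].
have [b] := name_infinite (restr s `|` domf s `|` fn P `|` bn P `|` X).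
rewrite !inE !negb_or => /andP [/andP [/andP [/andP [bs bd] bF] bB] bX].
have bP := pn_fresh bF bB; have cf := capture_free_rename a bP.
have ab : a != b by apply: contra bs => /eqP <-.
set s1 := ren_restr (rename a b) s.
have rs1 : restr s1 = b |` (restr s `\ a).
  by rewrite restr_ren_restr imfset_rename.
have vs1 : valid_sb s1.
  apply: valid_ren_restr => //.
    apply: (capture_free_rename (B := fset0) a _).1; by rewrite fsetU0.
  have [_ dis] := (valid_sbP s).1 vs.
  rewrite imfset_rename // fdisjointXU fdisjointX1 bd /=.
  by apply: fdisjointWr dis; subset_cases.
have [] := IH s1 (ren (rename a b) P) vs1 (wf_ren cf wP).
- by rewrite bn_ren.
- rewrite -ltnS; apply: leq_trans card.
  have /fproper_ltn_card : (restr s `&` X) `\ a `<` restr s `&` X.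
    by rewrite fproperD1 // inE as_.
  apply: leq_ltn_trans; apply: fsubset_leq_card; apply/fsubsetP => c.
  rewrite rs1 !inE => /andP [/orP [/eqP ->|/andP [-> ->]] cX //].
  by rewrite cX in bX.
move=> s' [P' [[al vs' wP' ds' fs'] dis]].
exists s', P'; split=> //; split=> //.
  by apply: cong_trans al; apply: cong_base; apply: alpha_Spawn.
rewrite fs' /= fn_ren // rs1; congr (_ `|` _).
rewrite -fsetDDl imfset_renameD //; apply/fsetP => c; rewrite !inE.
by case: (eqVneq c a) => [->|]; rewrite ?as_ // negb_and.
Qed.

(** Subterms are refreshed before their binder, so that the new binder can also avoid the bound
    names just chosen, as the alpha axioms require. *)
Lemma refresh P X : wf_proc P -> exists P', refreshes X P P'.
Proof.
elim: P X => [x y P IHP Q IHQ|x y P IH|x|x P IH|x l P IH|x P IHP Q IHQ|x y|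
  x P IHP Q IHQ|s P IH] X /=.
- case=> wP wQ; have [P' [[alP wP' fP dP] _]] := IHP X wP.
  have [Q' [[alQ wQ' fQ dQ] _]] := IHQ X wQ.
  have [b] := name_infinite (fn P' `|` bn P' `|` X).
  rewrite !inE !negb_or => /andP [/andP [bF bB] bX].
  have bP := pn_fresh bF bB; have cf := capture_free_rename y bP.
  exists (Out x b (ren (rename y b) P') Q'); split; split=> /=.
  + apply: cong_trans (cong_Out x y alP alQ) _.
    by apply: cong_base; apply: alpha_Out.
  + by split=> //; apply: wf_ren.
  + by rewrite fn_ren // imfset_renameD // fP fQ.
  + by rewrite bn_ren fdisjointU1X bX fdisjointUX dP.
  + by move=> k z H; inversion H; constructor.
  + by move=> k z H; inversion H; constructor.
  + by [].
- move=> wP; have [P' [[alP wP' fP dP] _]] := IH X wP.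
  have [b] := name_infinite (fn P' `|` bn P' `|` X).
  rewrite !inE !negb_or => /andP [/andP [bF bB] bX].
  have bP := pn_fresh bF bB; have cf := capture_free_rename y bP.
  exists (In x b (ren (rename y b) P')); split; split=> /=.
  + apply: cong_trans (cong_In x y alP) _.
    by apply: cong_base; apply: alpha_In.
  + exact: wf_ren.
  + by rewrite fn_ren // imfset_renameD // fP.
  + by rewrite bn_ren fdisjointU1X bX.
  + by move=> k z H; inversion H; constructor.
  + by move=> k z H; inversion H; constructor.
  + by [].
- exists (Close x); split; split=> //=; first exact: cong_refl.
  exact: fdisjoint0X.
- move=> wP; have [P' [[alP wP' fP dP] _]] := IH X wP.
  exists (Wait x P'); split; split=> //=; rewrite ?fP //.
  + exact: cong_Wait.
  + by move=> k z H; inversion H.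
  + by move=> k z H; inversion H; constructor.
- move=> wP; have [P' [[alP wP' fP dP] _]] := IH X wP.
  exists (Sel x l P'); split; split=> //=; rewrite ?fP //.
  + exact: cong_Sel.
  + by move=> k z H; inversion H; constructor.
  + by move=> k z H; inversion H.
- case=> wP wQ; have [P' [[alP wP' fP dP] _]] := IHP X wP.
  have [Q' [[alQ wQ' fQ dQ] _]] := IHQ X wQ.
  exists (Case x P' Q'); split; split=> //=; rewrite ?fP ?fQ ?fdisjointUX ?dP //.
  + exact: cong_Case.
  + by move=> k z H; inversion H.
  + by move=> k z H; inversion H; constructor.
- exists (Fwd x y); split; split=> //=; first exact: cong_refl.
  exact: fdisjoint0X.
- case=> wP wQ.
  have [P' [[alP wP' fP dP] [pP deP _]]] := IHP X wP.
  have [Q' [[alQ wQ' fQ dQ] [pQ deQ _]]] := IHQ X wQ.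
  have [b] := name_infinite (fn P' `|` bn P' `|` (fn Q' `|` bn Q') `|` X).
  rewrite !inE !negb_or.
  move=> /andP [/andP [/andP [bFP bBP] /andP [bFQ bBQ]] bX].
  have bP := pn_fresh bFP bBP; have bQ := pn_fresh bFQ bBQ.
  have cfP := capture_free_rename x bP; have cfQ := capture_free_rename x bQ.
  exists (Nu b (ren (rename x b) P') (ren (rename x b) Q')); split; split=> /=.
  + apply: cong_trans (cong_Nu x alP alQ) _.
    by apply: cong_base; apply: alpha_Nu.
  + by split; apply: wf_ren.
  + rewrite !fn_ren // -imfsetU imfset_renameD ?fP ?fQ //.
    by rewrite -fP -fQ inE negb_or bFP.
  + by rewrite !bn_ren fdisjointU1X bX fdisjointUX dP.
  + move=> k z H; inversion H; subst.
    have zN : z \notin fn P by [].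
    have rz : rename x b z = z by rewrite /rename ifN.
    have zQ : z \in fn Q' by rewrite fQ; apply: provides_fn; eassumption.
    constructor.
    * by apply: contra bFQ => /eqP <-.
    * rewrite fn_ren //; apply/imfsetP => -[c /= cP]; rewrite /rename.
      case: eqP => [_ zb|_ zc]; first by rewrite -zb zQ in bFQ.
      by move/negP: zN; rewrite -fP zc.
    * by rewrite fn_ren // imfset_rename ?fQ // !inE eqxx.
    * by rewrite -rz; apply: provides_ren => //; apply: pQ.
  + move=> k z H; inversion H; subst.
    * have zN : z \notin fn Q by [].
      have rz : rename x b z = z by rewrite /rename ifN.
      have zP : z \in fn P' by rewrite fP; apply: demands_fn; eassumption.
      apply: demands_Nu_l.
      -- by apply: contra bFP => /eqP <-.
      -- rewrite fn_ren //; apply/imfsetP => -[c /= cQ]; rewrite /rename.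
         case: eqP => [_ zb|_ zc]; first by rewrite -zb zP in bFP.
         by move/negP: zN; rewrite -fQ zc.
      -- by rewrite -rz; apply: demands_ren => //; apply: deP.
    * have zN : z \notin fn P by [].
      have rz : rename x b z = z by rewrite /rename ifN.
      have zQ : z \in fn Q' by rewrite fQ; apply: demands_fn; eassumption.
      apply: demands_Nu_r.
      -- by apply: contra bFQ => /eqP <-.
      -- rewrite fn_ren //; apply/imfsetP => -[c /= cP]; rewrite /rename.
         case: eqP => [_ zb|_ zc]; first by rewrite -zb zQ in bFQ.
         by move/negP: zN; rewrite -fP zc.
      -- by rewrite -rz; apply: demands_ren => //; apply: deQ.
  + by [].
- case=> vs wP; have [P' [[alP wP' fP dP] _]] := IH X wP.
  have [s' [P2 [[al vs' wP2 ds fs] dis]]] := refresh_spawn vs wP' dP (leqnn _).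
  exists (Spawn s' P2); split; split=> //=.
  + exact: cong_trans (cong_Spawn s alP) al.
  + by move: fs => /= ->; rewrite fP.
  + by move=> k z H; inversion H.
  + by move=> k z H; inversion H.
  + by rewrite ds.
Qed.

End Readiness.

Definition action_of (A : type) : action :=
  match A with
  | Star _ _ | And _ _ => Send
  | Wand _ _ | Imp _ _ => Receive
  | OneM | OneA => Terminate
  | Or _ _ => Select
  end.

(** * Names declared by bunches, and spawn typing seen on names *)

Section Bunches.
Variable name : choiceType.
Implicit Types (s : spawn_binding name) (x y z u : name) (k : action).
Implicit Types (D : bunch name) (G : bctx name) (P Q : proc name).

Fixpoint declares u k D : Prop :=
  match D with
  | EmptyM | EmptyA => False
  | Leaf x A => u = x /\ k = action_of A
  | Comma D1 D2 | Semi D1 D2 => declares u k D1 \/ declares u k D2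
  end.

Definition ctx_names G := bunch_names (fill G EmptyM).

Definition ctx_dom G := bdom (fill G EmptyM).

Lemma perm_fill G D :
  perm_eq (bunch_names (fill G D)) (bunch_names D ++ ctx_names G).
Proof.
rewrite /ctx_names; elim: G => /= [|G IH D'|D' G IH|G IH D'|D' G IH];
  rewrite ?cats0 //.
- by rewrite catA perm_cat2r.
- by rewrite perm_sym perm_catCA perm_cat2l perm_sym.
- by rewrite catA perm_cat2r.
- by rewrite perm_sym perm_catCA perm_cat2l perm_sym.
Qed.

Lemma bequiv_perm D1 D2 : bequiv D1 D2 ->
  perm_eq (bunch_names D1) (bunch_names D2).
Proof.
elim=> //= {D1 D2}.
- by move=> D1 D2 _; rewrite perm_sym.
- by move=> D1 D2 D3 _ H1 _; apply: perm_trans H1.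
- by move=> D1 D1' D2 D2' _ H1 _ H2; apply: perm_cat.
- by move=> D1 D1' D2 D2' _ H1 _ H2; apply: perm_cat.
- by move=> D1 D2; rewrite perm_catC.
- by move=> D1 D2 D3; rewrite catA.
- by move=> D1 D2; rewrite perm_catC.
- by move=> D1 D2 D3; rewrite catA.
Qed.

Lemma bequiv_declares u k D1 D2 : bequiv D1 D2 ->
  declares u k D1 <-> declares u k D2.
Proof. by elim=> //= *; tauto. Qed.

Lemma declares_names u k D : declares u k D -> u \in bunch_names D.
Proof.
elim: D => //= [x A [-> _]|D1 IH1 D2 IH2|D1 IH1 D2 IH2]; first by rewrite inE.
  by rewrite mem_cat => -[/IH1 ->|/IH2 ->]; rewrite ?orbT.
by rewrite mem_cat => -[/IH1 ->|/IH2 ->]; rewrite ?orbT.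
Qed.

Lemma declares_fill u k G D :
  declares u k (fill G D) <-> declares u k D \/ declares u k (fill G EmptyM).
Proof. by elim: G => /= *; tauto. Qed.

Lemma in_bdom x D : (x \in bdom D) = (x \in bunch_names D).
Proof. by rewrite in_fset. Qed.

Lemma in_ctx_dom x G : (x \in ctx_dom G) = (x \in ctx_names G).
Proof. exact: in_bdom. Qed.

Lemma bdom_bequiv D1 D2 : bequiv D1 D2 -> bdom D1 = bdom D2.
Proof.
by move=> /bequiv_perm /perm_mem H; apply/fsetP => x; rewrite !in_bdom H.
Qed.

Lemma bdom_Comma D1 D2 : bdom (Comma D1 D2) = bdom D1 `|` bdom D2.
Proof. by apply/fsetP => x; rewrite inE !in_bdom mem_cat. Qed.

Lemma bdom_Semi D1 D2 : bdom (Semi D1 D2) = bdom D1 `|` bdom D2.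
Proof. by apply/fsetP => x; rewrite inE !in_bdom mem_cat. Qed.

Lemma bdom_Leaf x A : bdom (Leaf x A) = [fset x].
Proof. by apply/fsetP => y; rewrite in_bdom /= !inE. Qed.

Lemma bdom_EmptyM : bdom (@EmptyM name) = fset0.
Proof. by apply/fsetP => y; rewrite in_bdom /= !inE. Qed.

Lemma bdom_EmptyA : bdom (@EmptyA name) = fset0.
Proof. by apply/fsetP => y; rewrite in_bdom /= !inE. Qed.

Lemma bdom_fill G D : bdom (fill G D) = bdom D `|` ctx_dom G.
Proof.
apply/fsetP => x; rewrite in_fsetU in_ctx_dom !in_bdom (perm_mem (perm_fill G D)).
by rewrite mem_cat.
Qed.

Lemma names_copies n (rs : nat -> name -> name) D :
  bunch_names (\big[@Semi name/EmptyA]_(i < n) ren_bunch (rs i) D) =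
  [seq rs i a | i <- iota 0 n, a <- bunch_names D].
Proof.
rewrite (big_morph (@bunch_names name) (id1 := [::]) (op1 := cat)) //.
have namesE r : bunch_names (ren_bunch r D) = map r (bunch_names D).
  by elim: D => //= D1 -> D2 ->; rewrite map_cat.
rewrite -(big_mkord xpredT (fun i => bunch_names (ren_bunch (rs i) D))).
rewrite /index_iota subn0; elim: (iota 0 n) => [|i l IH]; first by rewrite big_nil.
by rewrite big_cons IH namesE.
Qed.

Lemma uniq_fill G D : uniq (bunch_names (fill G D)) =
  [&& uniq (bunch_names D), ~~ has (mem (bunch_names D)) (ctx_names G) &
      uniq (ctx_names G)].
Proof. by rewrite (perm_uniq (perm_fill G D)) cat_uniq. Qed.

Lemma uniq_copies n (rs : nat -> name -> name) D X :
  fresh_copies n rs (bdom D) X -> uniq (bunch_names D) ->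
  uniq (bunch_names (\big[@Semi name/EmptyA]_(i < n) ren_bunch (rs i) D)).
Proof.
move=> [_ inj] uD; rewrite names_copies; apply: allpairs_uniq => //.
  exact: iota_uniq.
move=> _ _ /allpairsP [[i a] /= [iP aP ->]] /allpairsP [[j b] /= [jP bP ->]] /=.
move: iP jP; rewrite !mem_iota => iP jP E.
by case: (inj i j a b iP jP _ _ E); rewrite ?in_bdom // => -> ->.
Qed.

(** This is the trace of spawn typing on names. The last clause, that names untouched by [s] pass
    through unchanged, is what computes the free names of [Spawn s P] from those of [P]. *)
Definition rebinds s D1 D2 : Prop :=
  [/\ valid_sb s, uniq (bunch_names D2), domf s `<=` bdom D1,
      restr s `<=` bdom D2 & bdom D1 `\` domf s = bdom D2 `\` restr s].

Lemma sb_typed_rebinds s D1 D2 : sb_typed s D1 D2 ->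
  uniq (bunch_names D1) -> rebinds s D1 D2.
Proof.
elim=> {s D1 D2} [G D n rs fr|G D1 D2|s t D0 D1 D2 _ IH1 _ IH2 vst|
  s D1 D1' D2 D2' eq1 eq2 _ IH] u1.
- set C := \big[_/_]_(_ < _) _.
  have memC c : (c \in bdom C) = (c \in restr (copies_sb n rs (bdom D))).
    rewrite in_bdom names_copies; apply/allpairsP/restr_copies => /=.
      move=> [[i a] /= [iP aP ->]]; exists i, a.
      by move: iP; rewrite mem_iota in_bdom.
    move=> [i [a [iP aP ->]]]; exists (i, a).
    by rewrite mem_iota /= -in_bdom.
  have CE : bdom C = restr (copies_sb n rs (bdom D)) by apply/fsetP.
  have subX : bdom D `<=` bdom (fill G D) by rewrite bdom_fill; subset_cases.
  have /fdisjointP dis := restr_copies_fresh fr.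
  move: (u1); rewrite uniq_fill => /and3P [uD /hasPn nG uG]; split.
  + exact: valid_copies subX fr.
  + rewrite uniq_fill (uniq_copies fr uD) uG andbT; apply/hasPn => c cG.
    rewrite /= -in_bdom memC; apply/negP => /dis.
    by rewrite bdom_fill in_fsetU in_ctx_dom cG orbT.
  + exact: subX.
  + by rewrite bdom_fill CE; subset_cases.
  + rewrite !bdom_fill CE; apply/fsetP => c; rewrite !in_setopsE.
    have := dis c; rewrite bdom_fill !in_setopsE /=.
    have := nG c; rewrite /= -in_ctx_dom -in_bdom.
    membership_cases.
- have uF := u1; move: u1; rewrite uniq_fill /= cat_uniq.
  move=> /and3P [/and3P [uD1 /hasPn n12 uD2] /hasPn nG uG]; split.
  + exact: valid_discard.
  + rewrite uniq_fill uD2 uG andbT; apply/hasPn => c /nG; apply: contra.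
    by rewrite /= !mem_cat => ->; rewrite orbT.
  + by rewrite bdom_fill bdom_Semi; subset_cases.
  + by rewrite restr_discard.
  + rewrite restr_discard !bdom_fill bdom_Semi; apply/fsetP => c; rewrite !in_setopsE.
    have := n12 c; have := nG c; rewrite /= mem_cat -in_ctx_dom -!in_bdom; membership_cases.
- have [v1 uD1 d1 r1 e1] := IH1 u1; have [v2 uD2 d2 r2 e2] := IH2 uD1.
  have pt (A B : {fset name}) : A = B -> forall c, (c \in A) = (c \in B).
    by move=> ->.
  move/pt in e1; move/pt in e2.
  move: d1 d2 r1 r2 => /fsubsetP d1 /fsubsetP d2 /fsubsetP r1 /fsubsetP r2.
  (* A name of both domains belongs to [bdom D1] by [d2] and is not left untouched by [s], so [e1]
     makes it restricted by [s]. *)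
  have rE : restr (sb_merge s t) = restr t `|` (restr s `\` domf t).
    apply: restr_merge; apply/fsubsetP => c; have := e1 c; have := d2 c.
    membership_cases.
  split=> //.
  + apply/fsubsetP => c /=; have := d1 c; have := d2 c; have := e1 c.
    membership_cases.
  + rewrite rE; apply/fsubsetP => c; have := r1 c; have := r2 c; have := e2 c.
    membership_cases.
  + rewrite rE; apply/fsetP => c /=; have := r1 c; have := r2 c.
    have := d1 c; have := d2 c; have := e1 c; have := e2 c.
    membership_cases.
- have pm1 := bequiv_perm eq1; have pm2 := bequiv_perm eq2.
  have [v uD2 d r e] := IH (eq_ind_r is_true u1 (perm_uniq pm1)).
  split=> //; rewrite -?(bdom_bequiv eq1) -?(bdom_bequiv eq2) //.
  by rewrite -(perm_uniq pm2).
Qed.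

Lemma typed_distinct D P z C : typed D P z C -> distinct D z.
Proof.
elim=> //= {}D D' {}P {}z {}C /bequiv_perm pm _; rewrite /distinct /=.
by rewrite (perm_mem pm) (perm_uniq pm).
Qed.

End Bunches.

(** * Reducing a cut *)

Section Reducibility.
Variable name : choiceType.
Implicit Types (s : spawn_binding name) (r : name -> name) (k : action).
Implicit Types (a b x y z u : name) (A B F X : {fset name}) (P Q : proc name).

Definition reducible P : Prop := exists S, wf_proc S /\ step P S.

Lemma alpha_sc_cong P Q : alpha P Q -> sc P Q.
Proof.
elim=> *; [|exact: cong_refl|exact: cong_sym|apply: cong_trans; eassumption|
  exact: cong_Out|exact: cong_In|exact: cong_Wait|exact: cong_Sel|
  exact: cong_Case|exact: cong_Nu|exact: cong_Spawn].
by apply: cong_base; apply: sc_alpha.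
Qed.

Lemma reducible_sc P P' : sc P P' -> reducible P' -> reducible P.
Proof.
move=> PP' [S [wS st]]; exists S; split=> //.
exact: step_sc PP' st (cong_refl _ _).
Qed.

Lemma reducible_Nu_l x P Q : wf_proc Q -> reducible P -> reducible (Nu x P Q).
Proof.
by move=> wQ [S [wS st]]; exists (Nu x S Q); split=> //; apply: step_ctx_nu_l.
Qed.

Lemma reducible_Nu_r x P Q : wf_proc P -> reducible Q -> reducible (Nu x P Q).
Proof.
by move=> wP [S [wS st]]; exists (Nu x P S); split=> //; apply: step_ctx_nu_r.
Qed.

Lemma reducible_Spawn s P : valid_sb s -> reducible P -> reducible (Spawn s P).
Proof.
by move=> vs [S [wS st]]; exists (Spawn s S); split=> //; apply: step_ctx_spawn.
Qed.

(* The Barendregt convention for the two sides of a cut on [x], together with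
   linearity: they share no other free name. *)
Definition apart x P Q : Prop :=
  [/\ forall a, a \in bn P -> a \notin fn Q,
      forall a, a \in bn Q -> a \notin fn P,
      forall a, a \in bn P -> a \notin bn Q &
      forall a, a \in fn P -> a \in fn Q -> a = x].

(** [R] stands for either side of the inner cut; its only new free name can be the binder [y], which
    [P] avoids. *)
Lemma apart_Nu_r x y P Q1 Q2 R : fn R `\ y `<=` fn (Nu y Q1 Q2) ->
  bn R `<=` bn (Nu y Q1 Q2) -> apart x P (Nu y Q1 Q2) -> apart x P R.
Proof.
move=> /fsubsetP fR /fsubsetP bR [H1 H2 H3 H4].
have yB : y \in bn (Nu y Q1 Q2) by rewrite /= !inE eqxx.
split=> a.
- move=> aP; apply: contra (H1 a aP) => aR; apply: fR; rewrite !inE aR andbT.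
  by apply: contraTneq aP => ->; apply/negP => /H3; rewrite yB.
- by move=> /bR /H2.
- by move=> /H3; apply: contra => /bR.
- move=> aP aR; apply: H4 => //; apply: fR; rewrite !inE aR andbT.
  by apply: contraTneq aP => ->; apply: H2.
Qed.

Lemma apart_Nu_l x y P1 P2 R Q : fn R `\ y `<=` fn (Nu y P1 P2) ->
  bn R `<=` bn (Nu y P1 P2) -> apart x (Nu y P1 P2) Q -> apart x R Q.
Proof.
move=> fR bR [H1 H2 H3 H4].
have : apart x Q R.
  apply: apart_Nu_r fR bR _; split=> // a; last by move=> ? ?; apply: H4.
  by move=> aQ; apply/negP => /H3; rewrite aQ.
move=> [K1 K2 K3 K4]; split=> // a; last by move=> ? ?; apply: K4.
by move=> aR; apply/negP => /K3; rewrite aR.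
Qed.

Lemma rename_binder y b P : b \notin pn P -> wf_proc P ->
  wf_proc (ren (rename y b) P).
Proof. by move=> bP; apply: wf_ren; apply: capture_free_rename. Qed.

(** Induction on the demand: [sc_assoc] or [sc_swap] moves the cut on [x] inside each cut of the
    client, until it meets the demanding prefix or forwarder. Excluding cuts for [P] leaves one
    provider per action. *)
Lemma cut_reducible_prefix k x P Q : (forall y P1 P2, P <> Nu y P1 P2) ->
  provides k x P -> demands k x Q -> wf_proc P -> wf_proc Q -> apart x P Q ->
  reducible (Nu x P Q).
Proof.
move=> nNu pP dQ; elim: dQ nNu pP => {k x Q}
  [x y Q|x y Q1 Q2|x Q|x Q1 Q2|k y x yx|k y x Q1 Q2 xy xQ dQ IH|
   k y x Q1 Q2 xy xQ dQ IH] nNu pP wP wQ ap.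
- inversion pP; subst; last by case: (nNu x0 P0 Q0).
  case: ap wP => /= H1 _ H3 _ [wP0 wQ0].
  have := H1 y0; have := H3 y0; rewrite !in_setopsE eqxx /= !negb_or.
  move=> /(_ isT) /andP [y0y y0B] /(_ isT) /andP [y0x y0F].
  have y0Q : y0 \notin pn Q.
    by rewrite in_fsetU negb_or y0B andbT; move: y0F; rewrite (negPf y0y).
  (* [step_comm_r] wants the same bound name on both sides, so the binder of the client becomes that
     of the provider, which [apart] makes fresh for the client. *)
  exists (Nu x Q0 (Nu y0 P0 (ren (rename y y0) Q))); split.
    by do !split=> //; apply: rename_binder.
  apply: (step_sc (P' := Nu x (Out x y0 P0 Q0) (In x y0 (ren (rename y y0) Q))))
    (step_comm_r _ _ _ _) (cong_refl _ _); last by rewrite eq_sym.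
  apply: cong_Nu; first exact: cong_refl.
  by apply: cong_base; apply: sc_alpha; apply: alpha_In.
- inversion pP; subst; last by case: (nNu x0 P0 Q).
  case: ap wQ => /= H1 _ H3 _ [wQ1 wQ2].
  have := H1 y0; have := H3 y0; rewrite !in_setopsE eqxx /= !negb_or.
  move=> /(_ isT) /and3P [y0y y0B _] /(_ isT) /and3P [y0x y0F _].
  have y0Q : y0 \notin pn Q1.
    by rewrite in_fsetU negb_or y0B andbT; move: y0F; rewrite (negPf y0y).
  exists (Nu x (Nu y0 (ren (rename y y0) Q1) P0) Q2); split.
    by do !split=> //; apply: rename_binder.
  apply: (step_sc (P' := Nu x (In x y0 P0) (Out x y0 (ren (rename y y0) Q1) Q2)))
    (step_comm_l _ _ _ _) (cong_refl _ _); last by rewrite eq_sym.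
  apply: cong_Nu; first exact: cong_refl.
  by apply: cong_base; apply: sc_alpha; apply: alpha_Out.
- inversion pP; subst; last by case: (nNu x0 P0 Q0).
  by exists Q; split=> //; apply: step_unit_r.
- inversion pP; subst; last by case: (nNu x0 P0 Q).
  exists (Nu x P0 (match l with Inl => Q1 | Inr => Q2 end)); split.
    by case: wQ => w1 w2; split=> //; case: (l).
  exact: step_case.
- case: ap => /= H1 H2 H3 H4.
  have yP : y \notin pn P.
    rewrite in_fsetU negb_or; apply/andP; split.
      by apply: contra yx => yP; rewrite -(H4 y) // !inE eqxx.
    by apply/negP => /H1; rewrite !inE eqxx.
  exists (ren (rename x y) P); split; first exact: rename_binder.
  move: yP; rewrite in_fsetU negb_or => /andP [yF yB].
  by apply: step_fwd_r => //; rewrite eq_sym.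
- have ap1 : apart x P Q1 by apply: apart_Nu_r ap => /=; subset_cases.
  case: wQ => wQ1 wQ2; have xP := provides_fn pP.
  apply: (reducible_sc (P' := Nu y (Nu x P Q1) Q2)).
    apply: cong_base; apply: sc_assoc => //.
    by case: ap => _ H2 _ _; apply: H2; rewrite /= !inE eqxx.
  by apply: reducible_Nu_l => //; apply: IH.
- have ap2 : apart x P Q2 by apply: apart_Nu_r ap => /=; subset_cases.
  case: wQ => wQ1 wQ2; have xP := provides_fn pP.
  apply: (reducible_sc (P' := Nu y Q1 (Nu x P Q2))).
    apply: cong_base; apply: sc_swap => //.
    by case: ap => _ H2 _ _; apply: H2; rewrite /= !inE eqxx.
  by apply: reducible_Nu_r => //; apply: IH.
Qed.

(** The cuts of the provider are peeled in turn, by [sc_assoc] read from right to left. *)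
Lemma cut_reducible k x P Q :
  provides k x P -> demands k x Q -> wf_proc P -> wf_proc Q -> apart x P Q ->
  reducible (Nu x P Q).
Proof.
move=> pP; elim: pP Q => {k x P} [x y P1 P2|x y P|x|x l P|
  k y x P1 P2 xy xP1 yP2 pP2 IH] Q dQ wP wQ ap;
  try by apply: (cut_reducible_prefix _ _ dQ) => //; constructor.
have ap2 : apart x P2 Q by apply: apart_Nu_l ap => /=; subset_cases.
case: wP => wP1 wP2; apply: (reducible_sc (P' := Nu y P1 (Nu x P2 Q))).
  apply: cong_sym; apply: cong_base; apply: sc_assoc => //; first by rewrite eq_sym.
  by case: ap => H1 _ _ _; apply: H1; rewrite /= !inE eqxx.
by apply: reducible_Nu_r => //; apply: IH.
Qed.

Lemma cut_Spawn_l x s P Q : wf_proc (Spawn s P) -> wf_proc Q ->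
  x \notin domf s -> x \in fn Q -> apart x (Spawn s P) Q ->
  reducible (Nu x (Spawn s P) Q).
Proof.
move=> [vs wP] wQ xs xQ [H1 _ _ _]; exists (Spawn s (Nu x P Q)); split=> //.
have rQ a : a \in restr s -> a \notin fn Q.
  by move=> aR; apply: H1; rewrite /= in_fsetU aR.
apply: step_spawn_l => //; last by apply/fdisjointP.
by apply: contraL xQ; apply: rQ.
Qed.

Lemma cut_Spawn_r x P s Q : wf_proc P -> wf_proc (Spawn s Q) ->
  x \notin domf s -> x \in fn P -> apart x P (Spawn s Q) ->
  reducible (Nu x P (Spawn s Q)).
Proof.
move=> wP [vs wQ] xs xP [_ H2 _ _]; exists (Spawn s (Nu x P Q)); split=> //.
have rP a : a \in restr s -> a \notin fn P.
  by move=> aR; apply: H2; rewrite /= in_fsetU aR.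
apply: step_spawn_r => //; last by apply/fdisjointP.
by apply: contraL xP; apply: rP.
Qed.

Hypothesis name_infinite : forall X, exists a : name, a \notin X.

Lemma fresh_seq n X : exists l : seq name,
  [/\ size l = n, uniq l & forall a, a \in l -> a \notin X].
Proof.
elim: n => [|n [l [sl ul lX]]]; first by exists [::].
have [a] := name_infinite (X `|` [fset b in l]).
rewrite in_fsetU in_fset negb_or => /andP [aX al].
exists (a :: l); split; rewrite /= ?sl ?al //.
by move=> b; rewrite inE => /orP [/eqP ->|/lX].
Qed.

(** The pair of [i] and [a] takes position [i * size A + index a A] in a list of fresh names;
    Euclidean division by [size A] recovers the pair. *)
Lemma fresh_copies_exist n A X : exists rs, fresh_copies n rs A X.
Proof.
have [l [sl ul lX]] := fresh_seq (n * size A) X.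
have [->|[a0 _]] := fset_0Vmem A.
  by exists (fun _ => id); split=> [i a|i j a b]; rewrite ?inE //= => _ _ ;
     rewrite inE.
exists (fun i a => nth a0 l (i * size A + index a A)).
have lt i a : i < n -> a \in A -> i * size A + index a A < size l.
  move=> iP aA; rewrite sl; apply: leq_trans (_ : i.+1 * size A <= _).
    by rewrite mulSn addnC ltn_add2r index_mem.
  by rewrite leq_mul2r iP orbT.
split=> [i a iP aA|i j a b iP jP aA bA /eqP].
  by apply/lX/mem_nth/lt.
rewrite nth_uniq ?lt // => /eqP E.
have ia : index a A < size A by rewrite index_mem.
have ib : index b A < size A by rewrite index_mem.
have A0 : 0 < size A by apply: leq_trans ia.
have ij : i = j.
  by have := congr1 (divn^~ (size A)) E; rewrite !divnMDl // !divn_small // !addn0.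
split=> //; move: E; rewrite ij => /addnI E.
by rewrite -(nth_index a0 aA) E nth_index.
Qed.

Lemma sb_app_cat s t a :
  sb_app (s + t)%fmap a = if a \in domf t then sb_app t a else sb_app s a.
Proof. by rewrite /sb_app fnd_cat; case: ifP. Qed.

Lemma sb_app_rem1 s x a :
  sb_app s.[~ x] a = if a == x then fset0 else sb_app s a.
Proof. by rewrite /sb_app fnd_rem1; case: eqP. Qed.

Lemma cut_Spawn_copy x P s Q : wf_proc P -> wf_proc (Spawn s Q) ->
  x \in domf s -> x \in fn P -> apart x P (Spawn s Q) ->
  reducible (Nu x P (Spawn s Q)).
Proof.
move=> wP [vs wQ] xs xP [H1 H2 H3 H4].
set copied := enum_fset (sb_app s x); set n := size copied.
pose X := x |` (pn P `|` pn Q `|` domf s `|` restr s).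
have [rs0 [rs0X rs0i]] := fresh_copies_exist n (fn P `\ x) X.
pose rs i a := if a == x then nth x copied i else if a \in fn P then rs0 i a else a.
have rsx i : rs i x = nth x copied i by rewrite /rs eqxx.
have rsF i a : a \in fn P `\ x -> rs i a = rs0 i a.
  by rewrite /rs !inE => /andP [/negPf -> ->].
have fr : fresh_copies n rs (fn P `\ x) X.
  split=> [i a iP aF|i j a b iP jP aF bF]; rewrite ?rsF //; first exact: rs0X.
  exact: rs0i.
have xsR i : i < n -> nth x copied i \in restr s.
  by move=> iP; apply: (@sb_app_restr _ s x); apply: mem_nth.
have rP a : a \in restr s -> a \notin pn P.
  move=> aR; rewrite in_fsetU negb_or H2 /=; last by rewrite in_fsetU aR.
  by apply/negP => /H3; rewrite /= in_fsetU aR.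
have dP a : a \in domf s -> a \in fn P -> a = x.
  by move=> ad aP; apply: H4; rewrite //= in_fsetU ad orbT.
set s' := copies_sb n rs (fn P `\ x).
eexists; split; last first.
  apply: (step_spawn_cut (xs := copied) (rs := rs)) => //.
  - exact: fset_uniq.
  - by apply/fdisjointP.
  - move=> a ad; rewrite /= !in_setopsE => /andP [/eqP ax aP]; case: ax.
    apply: dP aP; have : a \in s.[~ x] := ad.
    by rewrite mem_remf1 => /andP [].
split.
  have /fdisjointP fX := restr_copies_fresh fr.
  move: (vs) => /valid_sbP [injs /fdisjointP dis]; apply/valid_sbP.
  (* An image of the union stems from the copies or from [s]; the copies are fresh for [restr s], so
     the two kinds never meet. *)
  have appE a c : c \in sb_app (s.[~ x] + s')%fmap a ->
      c \in sb_app s' a \/ a != x /\ c \in sb_app s a.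
    rewrite sb_app_cat sb_app_rem1; case: ifP => _; first by left.
    by case: eqP => // _; right.
  have no a b c : c \in sb_app s' a -> c \in sb_app s b -> False.
    move=> /sb_app_restr /fX; rewrite !in_setopsE => cX /sb_app_restr cR.
    by rewrite cR !orbT in cX.
  split=> [a b c /appE [ca|[_ ca]] /appE [cb|[_ cb]]|].
  - exact: copies_inj fr ca cb.
  - by case: (no _ _ _ ca cb).
  - by case: (no _ _ _ cb ca).
  - exact: injs ca cb.
  apply/fdisjointP => a; rewrite mem_catf mem_remf1 => ad.
  have adE : a \in domf s \/ a \in fn P `\ x.
    by case/orP: ad => [/andP [_ ?]|?]; [left|right].
  apply/restrP => -[b /appE [/sb_app_restr /fX|[_ /sb_app_restr aR]]].
    by case: adE; rewrite !in_setopsE; membership_cases.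
  case: adE => [/dis|]; first by rewrite aR.
  by have := rP a aR; rewrite !in_setopsE; membership_cases.
(* There remains the well-formedness of the nested cuts; the bound on the indices is carried along
   the induction because [nth x copied i] lies in [s(x)] only for [i < n]. *)
have : all (fun i => i < n) (iota 0 n).
  by apply/allP => i; rewrite mem_iota.
elim: (iota 0 n) => //= i l IH /andP [iP lP]; split; last exact: IH.
apply: wf_ren => //; split=> [a b aF bF|a aF].
  have rsR c : c \in fn P -> c != x -> rs i c \notin restr s.
    move=> cF cx; have /(fr.1 _ _ iP) : c \in fn P `\ x by rewrite !inE cx.
    by rewrite !in_setopsE; membership_cases.
  case: (eqVneq a x) => [->|ax]; case: (eqVneq b x) => [->|bx] //.
  - by move=> E; have := rsR b bF bx; rewrite -E rsx xsR.
  - by move=> E; have := rsR a aF ax; rewrite E rsx xsR.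
  - by move=> E; case: (fr.2 i i a b iP iP _ _ E); rewrite // !inE ?ax ?bx.
(* Both kinds of target avoid [bn P]: the elements of [s(x)] since [restr s] is apart from [P], the
   others by freshness. *)
right; case: (eqVneq a x) => [->|ax].
  by have := rP _ (xsR i iP); rewrite rsx in_fsetU negb_or => /andP [].
have /(fr.1 _ _ iP) : a \in fn P `\ x by rewrite !inE ax.
by rewrite !in_setopsE; membership_cases.
Qed.

End Reducibility.

(** * Progress, by induction on typing *)

Section Progress.
Variable name : choiceType.
Hypothesis name_infinite : forall X : {fset name}, exists a : name, a \notin X.
Implicit Types (s : spawn_binding name) (k : action).
Implicit Types (a b x y z u : name) (X : {fset name}) (P Q : proc name).
Implicit Types (D : bunch name) (G : bctx name) (A C : type).

(** The order matters: [Q] is refreshed second, against the binders already chosen for [P']. *)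
Lemma refresh_apart x P Q : wf_proc P -> wf_proc Q ->
  (forall a, a \in fn P -> a \in fn Q -> a = x) ->
  exists P' Q', [/\ refreshes (fn P `|` fn Q) P P',
    refreshes (fn P `|` bn P') Q Q' & apart x P' Q'].
Proof.
move=> wP wQ H.
have [P' rP] := refresh name_infinite (fn P `|` fn Q) wP.
have [Q' rQ] := refresh name_infinite (fn P `|` bn P') wQ.
exists P', Q'; split=> //.
case: rP => -[_ _ fP /fdisjointP dP] _; case: rQ => -[_ _ fQ /fdisjointP dQ] _.
split=> a; rewrite ?fP ?fQ.
- by move/dP; rewrite in_fsetU negb_or => /andP [].
- by move/dQ; rewrite in_fsetU negb_or => /andP [].
- by apply: contraL => /dQ; rewrite in_fsetU negb_or => /andP [].
- exact: H.
Qed.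

(** The demanded [u] may be restricted by [s] and unknown to the outer context, so only [u != z] is
    recorded; with an empty context this already excludes the demand. *)
Definition stuck_spawn z C P : Prop := exists s P1,
  [/\ P = Spawn s P1, z \notin domf s &
      provides (action_of C) z P1 \/ exists k u, u != z /\ demands k u P1].

Definition progressive D z C P : Prop :=
  [\/ reducible P, stuck_spawn z C P, provides (action_of C) z P |
      exists k u, declares u k D /\ demands k u P].

Lemma progressive_cut G D x z A C P Q :
  distinct (fill G D) z -> distinct D x -> distinct (fill G (Leaf x A)) z ->
  wf_proc P -> wf_proc Q -> fn P = x |` bdom D ->
  fn Q = z |` bdom (fill G (Leaf x A)) ->
  progressive D x A P -> progressive (fill G (Leaf x A)) z C Q ->
  progressive (fill G D) z C (Nu x P Q).
Proof.
rewrite /distinct !cons_uniq -!in_bdom => /andP [zGD uGD] /andP [xD uD].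
move=> /andP [zG uG] wP wQ fP fQ.
have xG : x \notin ctx_dom G.
  move: uG; rewrite uniq_fill => /and3P [_ /hasPn + _].
  by rewrite in_ctx_dom => H; apply/negP => /H /=; rewrite inE eqxx.
have DG a : a \in bdom D -> a \notin ctx_dom G.
  move: uGD; rewrite uniq_fill => /and3P [_ /hasPn + _].
  by rewrite in_ctx_dom => H aD; apply/negP => /H /negP; apply; rewrite /= -in_bdom.
move: zGD zG; rewrite !bdom_fill bdom_Leaf !in_fsetU !negb_or in_fset1.
move=> /andP [zD zG] /andP [zx _].
have xP : x \in fn P by rewrite fP !in_setopsE eqxx.
have xQ : x \in fn Q by rewrite fQ bdom_fill bdom_Leaf !in_setopsE eqxx orbT.
have lin a : a \in fn P -> a \in fn Q -> a = x.
  rewrite fP fQ bdom_fill bdom_Leaf !in_setopsE => /orP [/eqP //|aD].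
  case/or3P => [/eqP az|/eqP //|aG]; first by rewrite -az aD in zD.
  by have := DG a aD; rewrite aG.
have [P' [Q' [[[alP wP' fP' _] [pP dP sP]] [[alQ wQ' fQ' _] [pQ dQ sQ]] ap]]] :=
  refresh_apart wP wQ lin.
have red : reducible (Nu x P' Q') -> reducible (Nu x P Q).
  by apply: reducible_sc; apply: alpha_sc_cong; apply: cong_Nu.
case=> [rP|[s [P1 [PE xs _]]]|provP|[k [u [uD' demP]]]].
- by move=> _; apply: Or41; apply: reducible_Nu_l.
- move=> _; apply: Or41; apply: red; move: sP; rewrite PE /=.
  case: P' ap wP' {alP fP' pP dP} => //= s' P1' ap wP' [E].
  by apply: cut_Spawn_l; rewrite ?fQ' ?E.
(* Two outcomes remain for [P], each met by four for [Q]: in goals 1 to 4 [P] acts on [x], in goals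
   5 to 8 it waits on its own context. *)
all: case=> [rQ|[s [Q1 [QE zs _]]]|provQ|[l [v [vG demQ]]]].
1,5: by apply: Or41; apply: reducible_Nu_r.
1,4: apply: Or41; apply: red; move: sQ; rewrite QE /=;
  case: Q' ap wQ' {alQ fQ' pQ dQ} => //= s' Q1' ap wQ' _;
  have [xs|xs] := boolP (x \in domf s');
  [apply: cut_Spawn_copy|apply: cut_Spawn_r]; rewrite ?fP' //.
1,3: apply: Or43; constructor=> //; rewrite fP !in_setopsE negb_or zD andbT //.
(* A demand on [x] is for the action of its type [A], which is just what [P] provides; any other
   demanded name belongs to [G] and stays visible outside the cut. *)
- move: vG; rewrite declares_fill /= => -[[vx lA]|vG].
    apply: Or41; apply: red; apply: (cut_reducible (k := action_of A)) => //.
      exact: pP.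
    by apply: dQ; rewrite -vx -lA.
  have vG' : v \in ctx_dom G by rewrite in_ctx_dom; apply: declares_names vG.
  apply: Or44; exists l, v; split; first by rewrite declares_fill; right.
  apply: demands_Nu_r demQ; first by apply: contra xG => /eqP <-.
  rewrite fP !in_setopsE negb_or; apply/andP; split.
    by apply: contra xG => /eqP <-.
  by apply: contraL vG'; apply: DG.
- have uD2 : u \in bdom D by rewrite in_bdom; apply: declares_names uD'.
  apply: Or44; exists k, u; split; first by rewrite declares_fill; left.
  have ux : u != x by apply: contra xD => /eqP <-.
  apply: demands_Nu_l demP => //; rewrite fQ bdom_fill bdom_Leaf !in_setopsE.
  rewrite !negb_or ux (DG u uD2) !andbT.
  by apply: contra zD => /eqP <-.
Qed.

(** Two stacked prefixes merge, once the inner restricted names are refreshed away from the outer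
    binding; this is what keeps a stuck process down to one prefix. *)
Lemma progressive_Spawn s D1 D2 P z C : z \notin bdom D1 -> z \notin bdom D2 ->
  rebinds s D1 D2 -> wf_proc P -> progressive D2 z C P ->
  progressive D1 z C (Spawn s P).
Proof.
move=> zD1 zD2 [vs _ /fsubsetP dD1 _ _] wP.
have zs : z \notin domf s by apply: contra zD1 => /dD1.
case=> [rP|[s1 [P1 [PE _ _]]]|provP|[k [u [uD2 demP]]]].
- by apply: Or41; apply: reducible_Spawn.
- apply: Or41.
  have [P' [[al wP' _ dP'] [_ _ sP']]] :=
    refresh name_infinite (domf s `|` restr s) wP.
  apply: (reducible_sc (P' := Spawn s P')).
    by apply: alpha_sc_cong; apply: cong_Spawn.
  move: sP'; rewrite PE /=; case: P' wP' dP' {al} => //= t P' [vt wP'] dP' _.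
  have dt : [disjoint restr t & domf s `|` restr s].
    by apply: fdisjointWl dP'; subset_cases.
  exists (Spawn (sb_merge s t) P'); split; last exact: step_merge.
  by split=> //; apply: valid_merge.
- by apply: Or42; exists s, P; split=> //; left.
- apply: Or42; exists s, P; split=> //; right; exists k, u; split=> //.
  by apply: contra zD2 => /eqP <-; rewrite in_bdom; apply: declares_names uD2.
Qed.

(* The invariant of the progress argument; the representative [P'] supplies
   the validity of spawn bindings, which alpha-equivalence alone need not
   preserve. *)
Definition normalizes D P z C : Prop :=
  exists P', [/\ alpha P P', wf_proc P', fn P' = z |` bdom D &
                progressive D z C P'].

(** Freshness of [y] in the form that [membership_cases] can use, where [a == y] is an atom. *)
Lemma in_set_eq y X : y \notin X -> forall a, a == y -> a \notin X.
Proof. by move=> yX a /eqP ->. Qed.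

(** Bunches enter only through their names and types through their action, so one lemma serves the
    multiplicative rule and its additive twin; the same holds for the next ones. *)
Lemma normalizes_Out_r D D1 D2 P1 P2 x y A B C :
  action_of C = Send -> bdom D = bdom D1 `|` bdom D2 -> distinct D1 y ->
  normalizes D1 P1 y A -> normalizes D2 P2 x B ->
  normalizes D (Out x y P1 P2) x C.
Proof.
move=> CE DE /andP [yD _] [P1' [al1 w1 f1 _]] [P2' [al2 w2 f2 _]].
exists (Out x y P1' P2'); split=> //; first exact: cong_Out.
  rewrite /= f1 f2 DE; apply/fsetP => a; rewrite -in_bdom in yD.
  by have := in_set_eq yD (a := a); membership_cases.
by apply: Or43; rewrite CE; constructor.
Qed.

Lemma normalizes_In_r D D' P x y B C :
  action_of C = Receive -> bdom D' = bdom D `|` [fset y] ->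
  y \notin bdom D -> y != x -> normalizes D' P x B ->
  normalizes D (In x y P) x C.
Proof.
move=> CE DE yD yx [P' [al w f _]]; exists (In x y P'); split=> //.
- exact: cong_In.
- rewrite /= f DE; apply/fsetP => a.
  by have := in_set_eq yD (a := a); membership_cases.
- by apply: Or43; rewrite CE; constructor.
Qed.

Lemma normalizes_In_l G D P x y z A C :
  action_of A = Send -> bdom D = [fset x] `|` [fset y] ->
  y \notin ctx_dom G -> y != z -> normalizes (fill G D) P z C ->
  normalizes (fill G (Leaf x A)) (In x y P) z C.
Proof.
move=> AE DE yG yz [P' [al w f _]]; exists (In x y P'); split=> //.
- exact: cong_In.
- rewrite /= f !bdom_fill DE !bdom_Leaf; apply/fsetP => a.
  have yz1 : y \notin [fset z] by rewrite in_fset1.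
  have := in_set_eq yz1 (a := a).
  by have := in_set_eq yG (a := a); membership_cases.
- apply: Or44; exists Send, x; split; last by constructor.
  by rewrite declares_fill; left.
Qed.

Lemma normalizes_Out_l G D D' P Q x y z A B C :
  bdom D' = bdom D `|` [fset x] ->
  declares x Receive D' -> distinct D y ->
  normalizes D P y A -> normalizes (fill G (Leaf x B)) Q z C ->
  normalizes (fill G D') (Out x y P Q) z C.
Proof.
move=> DE xD' /andP [yD _] [P' [alP wP fP _]] [Q' [alQ wQ fQ _]].
exists (Out x y P' Q'); split=> //; first exact: cong_Out.
  rewrite /= fP fQ !bdom_fill DE bdom_Leaf; apply/fsetP => a.
  rewrite -in_bdom in yD.
  by have := in_set_eq yD (a := a); membership_cases.
apply: Or44; exists Receive, x; split; last by constructor.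
by rewrite declares_fill; left.
Qed.

Lemma normalizes_Wait G D P x z A C :
  action_of A = Terminate -> bdom D = fset0 ->
  normalizes (fill G D) P z C -> normalizes (fill G (Leaf x A)) (Wait x P) z C.
Proof.
move=> AE DE [P' [al w f _]]; exists (Wait x P'); split=> //.
- exact: cong_Wait.
- by rewrite /= f !bdom_fill DE bdom_Leaf; apply/fsetP => a; membership_cases.
- apply: Or44; exists Terminate, x; split; last by constructor.
  by rewrite declares_fill; left.
Qed.

Lemma normalizes_Sel D P x l A C : action_of C = Select ->
  normalizes D P x A -> normalizes D (Sel x l P) x C.
Proof.
move=> CE [P' [al w f _]]; exists (Sel x l P'); split=> //.
- exact: cong_Sel.
- by rewrite /= f; apply/fsetP => a; membership_cases.
- by apply: Or43; rewrite CE; constructor.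
Qed.

(** The left rules do not state that the bound [y] is new; this comes from the distinctness of the
    names declared by their premise. *)
Lemma distinct_binder_l G x y z B A (o : bunch name -> bunch name -> bunch name) :
  (o = @Comma name \/ o = @Semi name) ->
  distinct (fill G (o (Leaf x B) (Leaf y A))) z ->
  y \notin ctx_dom G /\ y != z.
Proof.
move=> oE; rewrite /distinct cons_uniq uniq_fill => /andP [zF /and3P [_ + _]].
have yin : y \in bunch_names (o (Leaf x B) (Leaf y A)).
  by case: oE => ->; rewrite /= !inE eqxx orbT.
move=> /hasPn H; split.
  by rewrite in_ctx_dom; apply/negP => /H /negP; apply.
apply: contra zF => /eqP <-; rewrite (perm_mem (perm_fill _ _)) mem_cat yin.
by [].
Qed.

Lemma distinct_binder_r D x y A (o : bunch name -> bunch name -> bunch name) :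
  (o = @Comma name \/ o = @Semi name) ->
  distinct (o D (Leaf y A)) x -> y \notin bdom D /\ y != x.
Proof.
move=> oE; rewrite /distinct.
have -> : bunch_names (o D (Leaf y A)) = bunch_names D ++ [:: y].
  by case: oE => ->.
rewrite cons_uniq mem_cat negb_or inE cats1 rcons_uniq -!in_bdom eq_sym.
by move=> /andP [/andP [_ ->] /andP [->]].
Qed.

Lemma typed_normalizes D P z C : typed D P z C -> normalizes D P z C.
Proof.
elim=> {D P z C}.
- move=> D1 D2 P1 P2 x y A B _ t1 IH1 _ IH2.
  apply: normalizes_Out_r (typed_distinct t1) IH1 IH2 => //.
  exact: bdom_Comma.
- move=> G P x y z A B C _ t IH.
  have [yG yz] := distinct_binder_l (or_introl erefl) (typed_distinct t).
  by apply: normalizes_In_l yG yz IH => //; rewrite bdom_Comma !bdom_Leaf.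
- move=> D P x y A B _ t IH.
  have [yD yx] := distinct_binder_r (or_introl erefl) (typed_distinct t).
  by apply: normalizes_In_r yD yx IH => //; rewrite bdom_Comma bdom_Leaf.
- move=> G D P Q x y z A B C _ t IH1 _ IH2.
  apply: normalizes_Out_l (typed_distinct t) IH1 IH2 => //.
    by rewrite bdom_Comma bdom_Leaf.
  by right.
- move=> x; exists (Close x); split=> //; first exact: cong_refl.
    by rewrite /= bdom_EmptyM fsetU0.
  by apply: Or43; constructor.
- by move=> G P x z C _ _; apply: normalizes_Wait; rewrite ?bdom_EmptyM.
- move=> D1 D2 P1 P2 x y A B _ t1 IH1 _ IH2.
  apply: normalizes_Out_r (typed_distinct t1) IH1 IH2 => //.
  exact: bdom_Semi.
- move=> G P x y z A B C _ t IH.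
  have [yG yz] := distinct_binder_l (or_intror erefl) (typed_distinct t).
  by apply: normalizes_In_l yG yz IH => //; rewrite bdom_Semi !bdom_Leaf.
- move=> D P x y A B _ t IH.
  have [yD yx] := distinct_binder_r (or_intror erefl) (typed_distinct t).
  by apply: normalizes_In_r yD yx IH => //; rewrite bdom_Semi bdom_Leaf.
- move=> G D P Q x y z A B C _ t IH1 _ IH2.
  apply: normalizes_Out_l (typed_distinct t) IH1 IH2 => //.
    by rewrite bdom_Semi bdom_Leaf.
  by right.
- move=> x; exists (Close x); split=> //; first exact: cong_refl.
    by rewrite /= bdom_EmptyA fsetU0.
  by apply: Or43; constructor.
- by move=> G P x z C _ _; apply: normalizes_Wait; rewrite ?bdom_EmptyA.
- by move=> D P x A B _ _; apply: normalizes_Sel.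
- by move=> D P x A B _ _; apply: normalizes_Sel.
- move=> G P Q x z A B C _ _ [P' [alP wP fP _]] _ [Q' [alQ wQ fQ _]].
  exists (Case x P' Q'); split=> //.
  + exact: cong_Case.
  + rewrite /= fP fQ !bdom_fill !bdom_Leaf; apply/fsetP => a.
    by membership_cases.
  + apply: Or44; exists Select, x; split; last by constructor.
    by rewrite declares_fill; left.
- move=> x y A; rewrite /distinct /= inE andbT => xy.
  exists (Fwd x y); split=> //; first exact: cong_refl.
    by rewrite /= bdom_Leaf.
  by apply: Or44; exists (action_of A), y; split=> //; constructor.
- move=> G D P Q x z A C dGD tP [P' [alP wP fP pP]] tQ [Q' [alQ wQ fQ pQ]].
  have dD := typed_distinct tP; have dG := typed_distinct tQ.
  exists (Nu x P' Q'); split=> //; first exact: cong_Nu.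
    move: (dD) (dG); rewrite /distinct !cons_uniq -!in_bdom uniq_fill.
    move=> /andP [xD _] /andP [zG /and3P [_ /hasPn xG _]].
    have {}xG : x \notin ctx_dom G.
      by rewrite in_ctx_dom; apply/negP => /xG /=; rewrite inE eqxx.
    have xz : x \notin [fset z].
      apply: contra zG; rewrite in_fset1 bdom_fill bdom_Leaf => /eqP ->.
      by rewrite !in_setopsE eqxx.
    rewrite /= fP fQ !bdom_fill bdom_Leaf; apply/fsetP => a.
    have := in_set_eq xD (a := a); have := in_set_eq xG (a := a).
    by have := in_set_eq xz (a := a); membership_cases.
  exact: progressive_cut pP pQ.
- move=> s D1 D2 P z C dD1 tP [P' [al wP fP pP]] /sb_typed_rebinds rb.
  move: dD1; rewrite /distinct cons_uniq -in_bdom => /andP [zD1 /rb {}rb].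
  move: (typed_distinct tP); rewrite /distinct cons_uniq -in_bdom.
  move=> /andP [zD2 _].
  exists (Spawn s P'); split.
  + exact: cong_Spawn.
  + by case: rb.
  + case: rb => _ _ /fsubsetP dD1 /fsubsetP rD2 DE; rewrite /= fP.
    apply/fsetP => a; have := dD1 a; have := rD2 a.
    have := in_set_eq zD2 (a := a); move/fsetP: (DE) => /(_ a).
    by membership_cases.
  + exact: progressive_Spawn pP.
- move=> D D' P z C eqD _ [P' [al w f p]]; exists P'; split=> //.
    by rewrite f (bdom_bequiv eqD).
  case: p => [?|?|?|[k [u [uD demP]]]]; [exact: Or41|exact: Or42|exact: Or43|].
  by apply: Or44; exists k, u; split=> //; apply/(bequiv_declares _ _ eqD).
- move=> D P P2 z C al _ [P' [al' w f p]]; exists P'; split=> //.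
  by apply: cong_trans al'; apply: cong_sym.
Qed.
End Progress.

Theorem theorem3p3 (name : choiceType)
    (name_infinite : forall X : {fset name}, exists a : name, a \notin X)
    (Sigma : bunch name) (P : proc name) (z : name) (A : type) :
  empty_bunch Sigma ->
  typed Sigma P z A ->
  A = OneM \/ A = OneA ->
  sc P (Close z) \/
  sc P (Spawn [fmap]%fmap (Close z)) \/
  (exists S : proc name, wf_proc S /\ step P S).
Proof.
move=> eS tP AE; have actA : action_of A = Terminate by case: AE => ->.
have S0 : bunch_names Sigma = [::].
  by elim: Sigma eS {tP} => //= D1 IH1 D2 IH2 /andP [/IH1 -> /IH2 ->].
have [P' [al w f]] := typed_normalizes name_infinite tP.
have {}f : fn P' = [fset z].
  by rewrite f; apply/fsetP => a; rewrite in_fsetU in_bdom S0 orbF.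
have scP := alpha_sc_cong al.
case=> [rP|[s [P1 [PE zs h]]]|provP|[k [u [/declares_names]]]]; last first.
- by rewrite S0.
- by left; rewrite -(provides_Terminate (P := P')) -?actA.
(* The domain of [s] consists of free names of [P'], hence of [z] at most, and [z] is excluded: so
   [s] is empty, [P1] has [z] as its only free name, and a demand on another name is impossible. *)
- right; left; move: f; rewrite PE /= => f.
  have s0 : s = [fmap]%fmap.
    apply: fmap_nil; apply/fsetP => a; rewrite in_fset0; apply/negP => as_.
    have : a \in [fset z] by rewrite -f in_fsetU as_ orbT.
    by rewrite in_fset1 => /eqP az; rewrite -az as_ in zs.
  have r0 : restr s = fset0.
    apply/fsetP => a; rewrite in_fset0; apply/negP => /restrP [b /sb_app_dom].
    by rewrite s0.
  have f1 : fn P1 = [fset z] by rewrite -f r0 s0 fsetD0 fsetU0.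
  case: h => [|[k [u [uz /demands_fn]]]]; last by rewrite f1 in_fset1 (negPf uz).
  by rewrite actA => /provides_Terminate P1E; rewrite -s0 -P1E -PE.
- by right; right; apply: reducible_sc rP.
Qed.
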